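(* Let $T \in \mathcal{B}(\mathcal{H})$ and let $g,h$ be non-negative continuous functions on $[0, \infty)$ satisfying $g(t) h(t)=t$ for all $t\geq 0$. Then for any Orlicz function $\phi$ and for any $\alpha \in [0,1]$, \[\phi\left(w^2(T) \right) \leq \left\|\frac{\alpha}{2}\left[ \phi \left(g^4(|T|)\right) + \phi \left(h^4(|T^*|) \right)\right] + (1-\alpha) \phi \left(|T|^2\right)\right\| \] and \[\phi\left(w^2(T) \right) \leq \left\|\frac{\alpha}{2}\left[ \phi \left(g^4(|T^*|)\right) + \phi \left(h^4(|T|) \right)\right] + (1-\alpha) \phi \left(|T^*|^2\right)\right\| .\]
   Context: $\mathcal{B}(\mathcal{H})$ is the algebra of bounded linear operators on a complex Hilbert space $\mathcal{H}$. For $T\in\mathcal{B}(\mathcal{H})$, $T^*$ is the adjoint, $|T|=(T^*T)^{1/2}$, $|T^*|=(TT^* )^{1/2}$, $\|T\|$ is the operator norm, $w(T)=\sup_{\|x\|=1}|\langle Tx,x\rangle|$ is the numerical radius, and $w^2(T)=(w(T))^2$. Functions of positive operators are defined by the continuous functional calculus; $g^4(|T|)=(g(|T|))^4$ and similarly for $h$. An Orlicz function is a continuous, convex, increasing function $\phi:[0,\infty)\to[0,\infty)$ with $\phi(0)=0$, $\phi(t)>0$ for all $t>0$, and $\lim_{t\to\infty}\phi(t)=\infty$. *)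

(* Defs.v *)
From HB Require Import structures.
From mathcomp Require Import all_boot all_order all_algebra.
From mathcomp Require Import sesquilinear complex.
From mathcomp Require Import all_classical all_reals all_analysis.

Set Implicit Arguments.
Unset Strict Implicit.
Unset Printing Implicit Defensive.

Import Order.TTheory GRing.Theory Num.Theory.
Import numFieldNormedType.Exports.

Local Open Scope classical_set_scope.
Local Open Scope ring_scope.
Local Open Scope complex_scope.

(* A complex Hilbert space over the reals R is a complete normed space H over
   R[i] with an inner product ip : {dot H for Num.conj} (linear in its first
   argument, conjugate-linear in the second) that induces the norm.
   Norms on H and on R[i] take values in R[i]; complex.Re brings them to R. *)
Definition induces_norm (R : realType) (H : completeNormedModType R[i])
    (ip : {dot H for @Num.conj R[i]}) : Prop :=
  forall x : H, `|x| ^+ 2 = ip x x.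

Section BoundedOperators.
Variables (R : realType) (H : completeNormedModType R[i]).
Implicit Types A B T : H -> H.

Definition bounded_op T : Prop := linear T /\ continuous T.

(* The values of [opnorm] and [numrad] are meaningful for bounded operators;
   on H = {0} both suprema are 0. *)
Definition opnorm T : R :=
  sup [set complex.Re `|T x| | x in [set x : H | `|x| <= 1]].

Definition spectrum T : set R[i] :=
  [set l | ~ exists S : H -> H, [/\ bounded_op S,
     (forall x, S (T x - l *: x) = x) & (forall x, T (S x) - l *: S x = x)]].

Definition poly_op (p : {poly R}) A : H -> H :=
  fun x => \sum_(i < size p) (p`_i)%:C *: iter i A x.

(* B is f(A) for the continuous functional calculus of the self-adjoint
   operator A: polynomials converging to f uniformly on the spectrum of A,
   evaluated at A, converge to B in operator norm.  The spectrum of a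
   self-adjoint operator is real, hence the restriction to t%:C, t in R. *)
Definition is_cfc (f : R -> R) A B : Prop :=
  bounded_op B /\
  exists p : nat -> {poly R},
    {uniform [set t : R | spectrum A t%:C],
       (fun n => horner (p n)) @ \oo --> f} /\
    (fun n => opnorm (poly_op (p n) A - B)) @ \oo --> (0 : R).

Definition cfc (f : R -> R) A : H -> H := xget 0 [set B | is_cfc f A B].

End BoundedOperators.

Section InnerProduct.
Variables (R : realType) (H : completeNormedModType R[i]).
Variable ip : {dot H for @Num.conj R[i]}.
Implicit Types T : H -> H.

Definition adjoint T : H -> H :=
  xget 0 [set S : H -> H | forall x y, ip (T x) y = ip x (S y)].

Definition numrad T : R :=
  sup [set complex.Re `|ip (T x) x| | x in [set x : H | `|x| = 1]].

Definition absop T : H -> H := cfc Num.sqrt (adjoint T \o T).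

End InnerProduct.

(* Functions on [0, +oo[ are represented by functions on R of which only the
   values on [0, +oo[ matter.  Monotonicity is required in the weak sense;
   strictness follows from convexity, phi 0 = 0 and positivity on ]0, +oo[. *)
Record orlicz (R : realType) (phi : R -> R) : Prop := Orlicz {
  orlicz_continuous : {within `[0, +oo[, continuous phi} ;
  orlicz_convex : convex_function (`[0, +oo[%classic : set R) (phi : R -> R^o) ;
  orlicz_increasing : {in `[0, +oo[ &, {homo phi : x y / x <= y}} ;
  orlicz0 : phi 0 = 0 ;
  orlicz_gt0 : forall t, 0 < t -> 0 < phi t ;
  orlicz_cvg : phi t @[t --> +oo] --> +oo }.

(* Main.v *)
(* For a unit vector x, the mixed Schwarz inequality
   |<Tx, x>| <= |g(|T|) x| |h(|T^*|) x| and the arithmetic-geometric mean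
   inequality give |<Tx, x>|^2 <= (<g^4(|T|) x, x> + <h^4(|T^*|) x, x>) / 2, while
   |<Tx, x>|^2 <= <|T|^2 x, x> by Cauchy-Schwarz.  Averaging the two bounds with
   weights alpha and 1 - alpha and applying phi, which is increasing and convex,
   leaves phi(<A x, x>) <= <phi(A) x, x> for positive A, which is Jensen's
   inequality and follows from a supporting line of phi.

   The functional calculus rests on |p(A)| <= sup |p| over the spectrum of a
   self-adjoint A: if N = |p(A)| exceeded the supremum, p(A) - N and p(A) + N
   would be invertible (factor p - N and p + N over the complex numbers), whereas
   N^2 - p(A)^2 never is.  With Weierstrass' theorem, every polynomial d-close
   to f on [0, |A|] is then d-close to f(A) at A, and the algebraic rules for
   f(A) follow by approximation. *)

Require Import Defs.
From HB Require Import structures.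
From mathcomp Require Import all_boot all_order all_algebra.
From mathcomp Require Import sesquilinear complex ring lra.
From mathcomp Require Import all_classical all_reals all_analysis.

Import Order.TTheory GRing.Theory Num.Theory.
Import numFieldNormedType.Exports.

Local Open Scope classical_set_scope.
Local Open Scope ring_scope.
Local Open Scope complex_scope.

Set Implicit Arguments.
Unset Strict Implicit.
Unset Printing Implicit Defensive.

(** * Weierstrass approximation *)

(** [adjoint] and [cfc] are picked by choice with 0 as fallback, so nothing can be said of them
    before existence is proved: Riesz representation supplies the adjoint, and completeness of [H]
    with the spectral bound supplies [cfc]. Invertibility is always traced back to coercivity: after
    multiplication by a suitable imaginary number, A - a with a non-real a satisfies a lower bound
    on Re <C x, x>, and so does, up to sign, a positive A minus a real number outside [0, M].
    Operators are compared pointwise: an identity follows once the norm of the difference at x is at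
    most a fixed multiple of every e > 0. The second inequality of the theorem is the first one for
    the adjoint of T, because T and its adjoint have the same numerical radius. *)

Section Weierstrass.
Variable R : realType.
Implicit Types (f : R -> R) (p : {poly R}) (e x y C M : R).

(** Composition with the absolute value extends [f] from the half-line to a continuous function on
    the whole line, which frees later arguments from the subspace topology. *)
Lemma within_continuous_normr f :
  {within `[0, +oo[, continuous f} -> continuous (fun t : R => f `|t|).
Proof.
move=> /subspace_continuousP fc x.
have x0 : `[0, +oo[%classic `|x| by rewrite /= in_itv /= normr_ge0.
have nc : `|t|%R @[t --> x] --> within `[0, +oo[ (nbhs `|x|).
  move=> U UU; have Ux : nbhs (x : R)
      (fun t : R => `[0, +oo[%classic `|t| -> U `|t|) := @norm_continuous _ R^o x _ UU.
  change (nbhs x (fun t : R => U `|t|)).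
  apply: filterS Ux => t; apply.
  by rewrite /= in_itv /= normr_ge0.
exact: (cvg_comp _ _ nc (fc _ x0)).
Qed.

(** Near the diagonal [e] absorbs the oscillation, away from it the quadratic term does; compactness
    of the square makes one [C] serve everywhere. The square is there to be matched with a
    variance. *)
Lemma quadratic_modulus f M e : continuous f -> 0 < e ->
  exists2 C, 0 <= C & forall x y, 0 <= x <= M -> 0 <= y <= M ->
    `|f x - f y| <= e + C * (x - y) ^+ 2.
Proof.
move=> fc e0.
pose K : set (R * R) := `[0, M]%classic `*` `[0, M]%classic.
have cK : compact K by apply: compact_setX; exact: segment_compact.
move/compact_near_coveringP: cK => /(_ R (pinfty_nbhs R) 
  (fun C t => `|f t.1 - f t.2| <= e + C * (t.1 - t.2) ^+ 2) _) cK.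
have {}cK : \forall C \near +oo, K `<=`
    (fun t => `|f t.1 - f t.2| <= e + C * (t.1 - t.2) ^+ 2).
  apply: cK => -[x0 y0] _ /=.
  have [C0 C00 hC0] : exists2 C0, 0 <= C0 &
      0 < e + C0 * (x0 - y0) ^+ 2 - `|f x0 - f y0|.
    have [->|xy] := eqVneq x0 y0.
      by exists 0 => //; rewrite !subrr normr0 mul0r addr0 subr0.
    (* This [C0] makes the quadratic term cancel [|f x0 - f y0|], leaving the slack [e]. *)
    exists (`|f x0 - f y0| / (x0 - y0) ^+ 2).
      by rewrite divr_ge0 // sqr_ge0.
    rewrite divfK ?addrK // expf_neq0 // subr_eq0 //.
  pose F (t : R * R) := e + C0 * (t.1 - t.2) ^+ 2 - `|f t.1 - f t.2|.
  have Fc : {for (x0, y0), continuous F}.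
    apply: cvgB; last first.
      apply: cvg_norm; apply: cvgB; apply: (@cvg_comp _ _ _ _ f).
      - exact: cvg_fst.
      - exact: fc.
      - exact: cvg_snd.
      - exact: fc.
    apply: cvgD; first exact: cvg_cst.
    apply: cvgM; first exact: cvg_cst.
    have D : (t.1 - t.2) @[t --> (x0, y0)] --> x0 - y0.
      by apply: cvgB; [exact: cvg_fst | exact: cvg_snd].
    by rewrite [_ ^+ 2]expr2; apply: cvgM.
  have n0 : \forall t \near (x0, y0), 0 < F t by exact: (cvgr_gt _ Fc).
  exists ([set t | 0 < F t], [set C | C0 < C]) => /=.
    split => //; exists C0; split => //; exact: num_real.
  move=> [t C] /= [Ft CC]; rewrite -subr_ge0; apply: le_trans (ltW Ft) _.
  by rewrite /F lerD2r lerD2l ler_wpM2r ?sqr_ge0 // ltW.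
have : \forall C \near +oo, 0 <= C /\ K `<=`
    (fun t => `|f t.1 - f t.2| <= e + C * (t.1 - t.2) ^+ 2).
  near=> C; split; near: C; last exact: cK.
  by exists 0; split; [exact: num_real|move=> z /= /ltW].
move=> [B [_ /(_ (B + 1))]]; rewrite ltrDl ltr01 => /(_ isT) [C0 CK].
exists (B + 1) => // x y xM yM; apply: (CK (x, y)).
by split => /=; rewrite in_itv.
Unshelve. all: by end_near. Qed.

(* Bernstein polynomials of the sequence phi, defined by the recurrence for
   binomial probabilities: (bernstein n phi).[x] is the expectation of
   phi(S_n), where S_n is a sum of n independent Bernoulli(x) variables. *)
Fixpoint bernstein n (phi : nat -> R) : {poly R} :=
  if n is n'.+1 then
    'X * bernstein n' (fun k => phi k.+1) + (1 - 'X) * bernstein n' phi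
  else (phi 0)%:P.

(** Induction on [n] by conditioning on one trial: a success shifts [phi] and hence replaces [y] by
    [y - 1]. The factor of [b] is the second moment of S_n about [y], variance plus squared bias. *)
Lemma bernstein_approx n (phi : nat -> R) (a b c x y : R) :
  0 <= x <= 1 -> 0 <= b ->
  (forall k, (k <= n)%N -> `|phi k - c| <= a + b * (k%:R - y) ^+ 2) ->
  `|(bernstein n phi).[x] - c| <=
    a + b * (n%:R * x * (1 - x) + (n%:R * x - y) ^+ 2).
Proof.
move=> /andP[x0 x1] b0; elim: n phi y => [|n IH] phi y phic /=.
  by rewrite hornerC !mul0r add0r phic.
have := IH phi y (fun k kn => phic k (leqW kn)).
have := IH (fun k => phi k.+1) (y - 1).
move=> /(_ _) H1 H2; have {}H1 := H1 _.
rewrite !hornerE.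
set u := (bernstein _ _).[x] in H1 *; set v := (bernstein _ _).[x] in H2 *.
have -> : x * u + (1 - x) * v - c = x * (u - c) + (1 - x) * (v - c) by ring.
apply: le_trans (ler_normD _ _) _; rewrite !normrM.
rewrite (ger0_norm x0) (ger0_norm (_ : 0 <= 1 - x)); last by rewrite subr_ge0.
apply: (@le_trans _ _ (x * (a + b * (n%:R * x * (1 - x) + (n%:R * x - (y - 1)) ^+ 2))
   + (1 - x) * (a + b * (n%:R * x * (1 - x) + (n%:R * x - y) ^+ 2)))).
  apply: lerD; rewrite ler_wpM2l ?subr_ge0 //; apply: H1 => k kn.
  have := phic k.+1 kn; rewrite -natr1.
  by have -> : k%:R + 1 - y = k%:R - (y - 1) by ring.
(* The second moment satisfies the recurrence exactly, so equality holds here. *)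
rewrite -natr1 le_eqVlt; apply/orP; left; apply/eqP; ring.
Qed.

Theorem weierstrass_approximation f M e : 0 < M ->
  {within `[0, +oo[, continuous f} -> 0 < e ->
  exists p, forall t, 0 <= t <= M -> `|p.[t] - f t| <= e.
Proof.
move=> M0 /within_continuous_normr fc e0.
have e20 : 0 < e / 2 by rewrite divr_gt0.
have [C C0 HC] := quadratic_modulus M fc e20.
pose n := (Num.truncn (C * M ^+ 2 / (e / 2))).+1.
have nC : C * M ^+ 2 / n%:R <= e / 2.
  rewrite ler_pdivrMr ?ltr0n // -ler_pdivrMl // mulrC.
  by rewrite ltW // truncnS_gt.
have n0 : n%:R != 0 :> R by rewrite pnatr_eq0.
have ngt0 : (0 < n)%N by [].
clearbody n.
exists (bernstein n (fun k => f `|k%:R * M / n%:R|) \Po (M^-1 *: 'X)) => t /andP[t0 tM].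
rewrite horner_comp hornerZ hornerX.
have x01 : 0 <= M^-1 * t <= 1.
  rewrite mulr_ge0 ?invr_ge0 ?(ltW M0) //= mulrC ler_pdivrMr // mul1r //.
set x := M^-1 * t in x01 *.
have tx : t = M * x by rewrite /x mulVKf // gt_eqF.
(* Centring at the mean n x removes the bias. The factor M^2 / n^2 converts the distance between the
   nodes k M / n and t into units of k. *)
have := @bernstein_approx n (fun k => f `|k%:R * M / n%:R|) (e / 2)
  (C * M ^+ 2 / n%:R ^+ 2) (f t) x (n%:R * x) x01.
have b0 : 0 <= C * M ^+ 2 / n%:R ^+ 2.
  by apply: divr_ge0; [apply: mulr_ge0|]; rewrite ?exprn_even_ge0 ?sqr_ge0.
move=> /(_ b0) h; apply: le_trans (h _) _.
  move=> k kn; have kM : 0 <= k%:R * M / n%:R <= M.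
    rewrite divr_ge0 ?mulr_ge0 ?(ltW M0) ?normr_ge0 //= ler_pdivrMr ?ltr0n //.
    by rewrite mulrC ler_pM2l // ler_nat.
  have := HC _ t kM; rewrite t0 tM => /(_ isT); rewrite (ger0_norm t0).
  move/le_trans; apply; rewrite lerD2l le_eqVlt; apply/orP; left; apply/eqP.
  by rewrite tx; field.
rewrite subrr expr0n /= addr0.
have -> : C * M ^+ 2 / n%:R ^+ 2 * (n%:R * x * (1 - x)) =
   C * M ^+ 2 / n%:R * (x * (1 - x)) by field.
rewrite [leRHS](splitr e) lerD2l; apply: le_trans nC.
rewrite ler_piMr //; first by
  apply: divr_ge0; [apply: mulr_ge0|]; rewrite ?exprn_even_ge0 ?sqr_ge0.
by case/andP: x01 => ? ?; nra.
Qed.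

End Weierstrass.

(** Closes the approximation arguments, whose errors come as [e] times a constant that may
    vanish. *)
Lemma le_of_add_eps (R : realFieldType) (x y c : R) :
  (forall e, 0 < e -> x <= y + c * e) -> x <= y.
Proof.
move=> h; apply/ler_addgt0Pr => e e0.
have c0 : 0 < `|c| + 1 by rewrite ltr_wpDl.
apply: le_trans (h (e / (`|c| + 1)) _) _; first by rewrite divr_gt0.
rewrite lerD2l mulrA ler_pdivrMr // mulrC ler_wpM2l ?(ltW e0) //.
by apply: le_trans (ler_norm c) _; rewrite lerDl.
Qed.

Lemma real_linear_form_eq0 (R : realFieldType) (a b : R) :
  0 <= b -> (forall t, t * a <= t ^+ 2 * b) -> a = 0.
Proof.
move=> b0 h; have b1 : 0 < b + 1 by rewrite ltr_wpDl.
(* The choice t = a / b would do for b > 0; adding 1 also covers b = 0. *)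
have := h (a / (b + 1)).
have -> : a / (b + 1) * a = a ^+ 2 / (b + 1) by field; rewrite gt_eqF.
rewrite ler_pdivrMr // => {}h.
have : a ^+ 2 * (b + 1) <= a ^+ 2 * b.
  apply: le_trans (_ : a ^+ 2 * (b + 1) <= (a / (b + 1)) ^+ 2 * b * (b + 1) ^+ 2) _.
    by rewrite [X in _ <= _ * X]expr2 mulrA ler_pM2r.
  by rewrite le_eqVlt; apply/orP; left; apply/eqP; field; rewrite gt_eqF.
rewrite mulrDr mulr1 gerDl => a2; apply/eqP; rewrite -sqrf_eq0 eq_le a2.
exact: sqr_ge0.
Qed.

Lemma invS_le (R : realType) (e : R) : 0 < e ->
  exists n : nat, forall m, (n <= m)%N -> (m.+1%:R^-1 : R) <= e.
Proof.
move=> e0; exists (Num.truncn e^-1) => m nm.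
rewrite invf_ple ?posrE ?ltr0n //; apply: le_trans (ltW (truncnS_gt _)) _.
by rewrite ler_nat ltnS.
Qed.

(** * Hilbert spaces *)

Section RealNorm.
Variable R : realType.

(** Real values put norm estimates within reach of [lra] and [nra]. *)
Definition rnorm (V : normedZmodType R[i]) (x : V) : R := complex.Re `|x|.

Section Zmod.
Variable V : normedZmodType R[i].
Implicit Types x y : V.

Lemma normE x : `|x| = (rnorm x)%:C.
Proof. by rewrite RRe_real // ger0_real. Qed.

Lemma rnorm_ge0 x : 0 <= rnorm x.
Proof. by rewrite -ler0c -normE. Qed.

Lemma rnorm0 : rnorm (0 : V) = 0.
Proof. by rewrite /rnorm normr0. Qed.

Lemma rnorm0_eq0 x : rnorm x = 0 -> x = 0.
Proof. by move=> x0; apply: normr0_eq0; rewrite normE x0. Qed.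

Lemma rnormN x : rnorm (- x) = rnorm x.
Proof. by rewrite /rnorm normrN. Qed.

Lemma rnorm_distC x y : rnorm (x - y) = rnorm (y - x).
Proof. by rewrite -rnormN opprB. Qed.

Lemma rnormD x y : rnorm (x + y) <= rnorm x + rnorm y.
Proof. by rewrite -lecR rmorphD /= -!normE ler_normD. Qed.

Lemma rnormB x y : rnorm (x - y) <= rnorm x + rnorm y.
Proof. by rewrite -(rnormN y) rnormD. Qed.

End Zmod.

Lemma rnorm_real (r : R) : rnorm r%:C = `|r|.
Proof. by rewrite /rnorm normc_def /= expr0n /= addr0 sqrtr_sqr. Qed.

Lemma Re_le_rnorm (a : R[i]) : complex.Re a <= rnorm a.
Proof.
rewrite -lecR -normE; apply: le_trans (normc_ge_Re a).
by rewrite lecR ler_norm.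
Qed.

Lemma ReD (a b : R[i]) : complex.Re (a + b) = complex.Re a + complex.Re b.
Proof. by case: a; case: b. Qed.

Lemma ReN (a : R[i]) : complex.Re (- a) = - complex.Re a.
Proof. by case: a. Qed.

Lemma ReZ r (b : R[i]) : complex.Re (r%:C * b) = r * complex.Re b.
Proof. by case: b => x y /=; rewrite mul0r subr0. Qed.

Lemma Re_conj (a : R[i]) : complex.Re (Num.conj a) = complex.Re a.
Proof. by apply: complexI; rewrite !complexRe Re_conj. Qed.

Lemma rnormZ (V : normedModType R[i]) (a : R[i]) (x : V) :
  rnorm (a *: x) = rnorm a * rnorm x.
Proof. by apply: complexI; rewrite rmorphM /= -!normE normrZ. Qed.
End RealNorm.

Section Hilbert.
Variables (R : realType) (H : completeNormedModType R[i]).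
Variable ip : {dot H for @Num.conj R[i]}.
Hypothesis ip_norm : induces_norm ip.
Implicit Types (x y z : H) (a : R[i]) (r : R) (S T A B : H -> H).

Lemma ipC x y : ip x y = Num.conj (ip y x).
Proof. by rewrite hermC expr0 mul1r. Qed.

Lemma ipDl x y z : ip (x + y) z = ip x z + ip y z.
Proof. exact: linearDl. Qed.

Lemma ipBl x y z : ip (x - y) z = ip x z - ip y z.
Proof. exact: linearBl. Qed.

Lemma ipBr x y z : ip x (y - z) = ip x y - ip x z.
Proof. exact: linearBr. Qed.

Lemma ipZl a x y : ip (a *: x) y = a * ip x y.
Proof. exact: linearZl_LR. Qed.

Lemma ipZr a x y : ip x (a *: y) = Num.conj a * ip x y.
Proof. exact: linearZr_LR. Qed.

Definition re_ip x y : R := complex.Re (ip x y).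

Lemma ripC x y : re_ip x y = re_ip y x.
Proof. by rewrite /re_ip ipC Re_conj. Qed.

Lemma ripDl x y z : re_ip (x + y) z = re_ip x z + re_ip y z.
Proof. by rewrite /re_ip ipDl ReD. Qed.

Lemma ripNl x y : re_ip (- x) y = - re_ip x y.
Proof. by rewrite /re_ip linearNl ReN. Qed.

Lemma ripBl x y z : re_ip (x - y) z = re_ip x z - re_ip y z.
Proof. by rewrite ripDl ripNl. Qed.

Lemma ripDr x y z : re_ip x (y + z) = re_ip x y + re_ip x z.
Proof. by rewrite ripC ripDl !(ripC x). Qed.

Lemma ripBr x y z : re_ip x (y - z) = re_ip x y - re_ip x z.
Proof. by rewrite ripC ripBl !(ripC x). Qed.

Lemma ripZl r x y : re_ip (r%:C *: x) y = r * re_ip x y.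
Proof. by rewrite /re_ip ipZl ReZ. Qed.

Lemma ripZr r x y : re_ip x (r%:C *: y) = r * re_ip x y.
Proof. by rewrite ripC ripZl ripC. Qed.

Lemma ip_rnorm x : ip x x = (rnorm x ^+ 2)%:C.
Proof. by rewrite -ip_norm normE rmorphXn. Qed.

Lemma rip_rnorm x : re_ip x x = rnorm x ^+ 2.
Proof. by rewrite /re_ip ip_rnorm. Qed.

Lemma rnorm_sqrD x y :
  rnorm (x + y) ^+ 2 = rnorm x ^+ 2 + rnorm y ^+ 2 + 2 * re_ip x y.
Proof. rewrite -!rip_rnorm ripDl !ripDr (ripC y x); ring. Qed.

Lemma rnorm_sqrB x y :
  rnorm (x - y) ^+ 2 = rnorm x ^+ 2 + rnorm y ^+ 2 - 2 * re_ip x y.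
Proof. rewrite -!rip_rnorm ripBl !ripBr (ripC y x); ring. Qed.

Lemma cauchy_schwarz x y : rnorm (ip x y) <= rnorm x * rnorm y.
Proof.
have [y0|yn0] := eqVneq (rnorm y) 0.
  by rewrite (rnorm0_eq0 y0) linear0r !rnorm0 mulr0.
have y0 : 0 < rnorm y ^+ 2 by rewrite exprn_gt0 // lt_neqAle eq_sym yn0 rnorm_ge0.
rewrite -ler_sqr ?nnegrE ?mulr_ge0 ?rnorm_ge0 //.
(* This vector is the component of [x] orthogonal to [y], multiplied by |y|^2 to avoid a
   division. *)
have := sqr_ge0 (rnorm ((rnorm y ^+ 2)%:C *: x - ip x y *: y)).
rewrite rnorm_sqrB !rnormZ rnorm_real ger0_norm ?sqr_ge0 // ripZl.
have -> : re_ip x (ip x y *: y) = rnorm (ip x y) ^+ 2.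
  rewrite /re_ip ipZr; have := normCK (ip x y); rewrite normE mulrC => <-.
  by rewrite -rmorphXn.
rewrite exprMn => h; rewrite -(ler_pM2l y0) -subr_ge0; apply: le_trans h _.
by rewrite le_eqVlt; apply/orP; left; apply/eqP; ring.
Qed.

Lemma rip_le x y : re_ip x y <= rnorm x * rnorm y.
Proof. exact: le_trans (Re_le_rnorm _) (cauchy_schwarz x y). Qed.

Lemma rnorm_cauchy_limit (u : nat -> H) :
  (forall e : R, 0 < e -> exists n, forall m k, (n <= m)%N -> (n <= k)%N ->
     rnorm (u m - u k) <= e) ->
  exists l, forall e : R, 0 < e -> exists n, forall m, (n <= m)%N ->
     rnorm (u m - l) <= e.
Proof.
move=> cu.
have /cauchy_cvgP/cvg_ex[l ul] : cauchy (u @ \oo).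
  apply/cauchy_ballP => e; rewrite ltcE => /andP[/eqP e0 re0].
  have ere : e = (complex.Re e)%:C.
    by case: e e0 {re0} => a b /= ->.
  have [n nu] := cu (complex.Re e / 2) (divr_gt0 re0 (ltr0n _ 2)).
  exists ([set x | exists2 m, (n <= m)%N & x = u m],
          [set x | exists2 m, (n <= m)%N & x = u m]).
    by split; exists n => // m /= nm; exists m.
  move=> [_ _] [/= [m nm ->] [k nk ->]] /=.
  rewrite -ball_normE /= normE ere ltcR.
  apply: le_lt_trans (nu _ _ nm nk) _.
  by rewrite ltr_pdivrMr // ltr_pMr // ltr1n.
exists l => e e0; move/cvgrPdist_le: ul => /(_ e%:C).
rewrite ltcR => /(_ e0) [n _ nu]; exists n => m nm.
by rewrite rnorm_distC -lecR -normE; exact: nu.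
Qed.

Definition bounded_by (K : R) T :=
  0 <= K /\ forall x, rnorm (T x) <= K * rnorm x.

Section LinearProp.
Variables (T : H -> H) (linT : linear T).
(** Operators are bare functions with a proof of linearity; packing them gives access to the lemmas
    on linear maps. *)
Let T' := HB.pack_for {linear H -> H} T (GRing.isLinear.Build _ _ _ _ T linT).

Lemma linear_propD x y : T (x + y) = T x + T y.
Proof. exact: (linearD T'). Qed.
Lemma linear_propB x y : T (x - y) = T x - T y.
Proof. exact: (linearB T'). Qed.
Lemma linear_prop0 : T 0 = 0.
Proof. exact: (linear0 T'). Qed.
Lemma linear_propZ a x : T (a *: x) = a *: T x.
Proof. exact: (linearZ_LR T'). Qed.
Lemma linear_prop_sum n (F : 'I_n -> H) : T (\sum_i F i) = \sum_i T (F i).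
Proof. exact: (linear_sum T'). Qed.
End LinearProp.

Lemma bounded_opP T :
  bounded_op T <-> linear T /\ exists K, bounded_by K T.
Proof.
split=> -[linT].
- pose T' := HB.pack_for {linear H -> H} T (GRing.isLinear.Build _ _ _ _ T linT).
  move=> /(_ 0) /(@continuous_linear_bounded _ _ _ 0 T').
  move=> /linear_boundedP /pinfty_ex_gt0 [M M0 hM]; split => //.
  have M0' := M0; move: M0'; rewrite ltcE => /andP[/eqP M1 M2].
  exists (complex.Re M); split; first exact: ltW.
  move=> x; rewrite -lecR rmorphM /= -!normE RRe_real ?gtr0_real //.
- move=> [K [K0 hK]]; split => // x; apply/cvgrPdist_le => e.
  rewrite ltcE => /andP[/eqP e0 re0].
  have ere : e = (complex.Re e)%:C by case: e e0 {re0} => a b /= ->.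
  have K1 : 0 < K + 1 by rewrite ltr_wpDl.
  have d0 : 0 < (complex.Re e / (K + 1))%:C by rewrite ltcR divr_gt0.
  have F := @cvgr_dist_le _ _ _ _ _ _ _ (@cvg_id _ (nbhs x)) _ d0.
  apply: filterS (F _) => y; rewrite !normE lecR => xy.
  rewrite ere lecR -(linear_propB linT); apply: le_trans (hK _) _.
  apply: (@le_trans _ _ ((K + 1) * rnorm (x - y))).
    by rewrite ler_wpM2r ?rnorm_ge0 // lerDl.
  by rewrite mulrC -ler_pdivlMr.
Qed.

Lemma bounded_op_linear T : bounded_op T -> linear T.
Proof. by case. Qed.

Lemma opnorm_bound T : bounded_op T -> bounded_by (opnorm T) T.
Proof.
move/bounded_opP => [linT [K [K0 hK]]].
have hub : has_ubound [set complex.Re `|T x| | x in [set x : H | `|x| <= 1]].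
  exists K => _ [x /= x1 <-]; apply: le_trans (hK x) _.
  by rewrite ler_piMr // -lecR -normE.
split.
  apply: (ub_le_sup hub); exists 0 => /=; first by rewrite normr0 ler01.
  by rewrite (linear_prop0 linT) normr0.
move=> x; have [x0|xn0] := eqVneq (rnorm x) 0.
  by rewrite (rnorm0_eq0 x0) (linear_prop0 linT) !rnorm0 mulr0.
have x0 : 0 < rnorm x by rewrite lt_neqAle eq_sym xn0 rnorm_ge0.
rewrite -ler_pdivrMr //; apply: (ub_le_sup hub).
exists ((rnorm x)^-1%:C *: x) => /=.
  rewrite normE rnormZ rnorm_real ger0_norm ?invr_ge0 ?rnorm_ge0 //.
  by rewrite mulVf.
rewrite (linear_propZ linT) -[LHS]/(rnorm _) rnormZ rnorm_real.
by rewrite ger0_norm ?invr_ge0 ?rnorm_ge0 // mulrC.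
Qed.

Lemma opnorm_le K T : bounded_by K T -> opnorm T <= K.
Proof.
move=> [K0 hK]; apply: ge_sup.
  by exists (complex.Re `|T 0|); exists 0 => //=; rewrite normr0 ler01.
move=> _ [x /= x1 <-]; apply: le_trans (hK x) _.
by rewrite ler_piMr // -lecR -normE.
Qed.

Lemma bounded_op_ub T : bounded_op T -> exists K, bounded_by K T.
Proof. by move/bounded_opP => []. Qed.

Lemma bounded_by_comp K L S T :
  bounded_by K S -> bounded_by L T -> bounded_by (K * L) (S \o T).
Proof.
move=> [K0 hS] [L0 hT]; split; first exact: mulr_ge0.
by move=> x; apply: le_trans (hS _) _; rewrite -mulrA ler_wpM2l.
Qed.

Lemma bounded_byD K L S T :
  bounded_by K S -> bounded_by L T -> bounded_by (K + L) (S + T).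
Proof.
move=> [K0 hS] [L0 hT]; split; first exact: addr_ge0.
by move=> x; apply: le_trans (rnormD _ _) _; rewrite mulrDl lerD.
Qed.

Lemma bounded_byZ a K T :
  bounded_by K T -> bounded_by (rnorm a * K) (a *: T).
Proof.
move=> [K0 hT]; split; first by rewrite mulr_ge0 ?rnorm_ge0.
by move=> x; rewrite rnormZ -mulrA ler_wpM2l ?rnorm_ge0.
Qed.

Lemma linear_comp S T : linear S -> linear T -> linear (S \o T).
Proof. by move=> hS hT a x y /=; rewrite hT hS. Qed.

Lemma bounded_op_comp S T : bounded_op S -> bounded_op T -> bounded_op (S \o T).
Proof.
move=> /bounded_opP[lS [K hK]] /bounded_opP[lT [L hL]]; apply/bounded_opP.
split; first exact: linear_comp.
by exists (K * L); exact: bounded_by_comp.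
Qed.

Lemma bounded_opD S T : bounded_op S -> bounded_op T -> bounded_op (S + T).
Proof.
move=> /bounded_opP[lS [K hK]] /bounded_opP[lT [L hL]]; apply/bounded_opP.
split; last by exists (K + L); exact: bounded_byD.
by move=> a x y; rewrite -![(S + T) _]/(S _ + T _) lS lT scalerDr addrACA.
Qed.

Lemma bounded_opZ a T : bounded_op T -> bounded_op (a *: T).
Proof.
move=> /bounded_opP[lT [L hL]]; apply/bounded_opP.
split; last by exists (rnorm a * L); exact: bounded_byZ.
move=> b x y; rewrite -![(a *: T) _]/(a *: T _) lT scalerDr.
by rewrite !scalerA mulrC.
Qed.

Lemma bounded_opB S T : bounded_op S -> bounded_op T -> bounded_op (S - T).
Proof.
by move=> bS bT; rewrite -[- T]scaleN1r; apply: bounded_opD => //; exact: bounded_opZ.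
Qed.

Lemma bounded_op_id : bounded_op (@id H).
Proof. by split => // x; exact: cvg_id. Qed.

Lemma bounded_op_iter n T : bounded_op T -> bounded_op (iter n T).
Proof.
move=> bT; elim: n => [|n IH]; first exact: bounded_op_id.
exact: (bounded_op_comp bT IH).
Qed.

End Hilbert.

(** * Coercive operators, Riesz representation and adjoints *)

Section HilbertTheory.
Variables (R : realType) (H : completeNormedModType R[i]).
Variable ip : {dot H for @Num.conj R[i]}.
Hypothesis ip_norm : induces_norm ip.
Implicit Types (x y z : H) (a : R[i]) (r : R) (S T A B : H -> H).
Local Notation rip := (re_ip ip).

Lemma geometric_small (q D e : R) : 0 <= q < 1 -> 0 <= D -> 0 < e ->
  exists n, forall m, (n <= m)%N -> q ^+ m * D <= e.
Proof.
move=> /andP[q0 q1] D0 e0.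
have D1 : 0 < D + 1 by rewrite ltr_wpDl.
have := @cvg_expr R q; rewrite ger0_norm // => /(_ q1) /cvgr0Pnorm_le.
move=> /(_ (e / (D + 1))); rewrite divr_gt0 // => /(_ isT) [n _ hn].
exists n => m /hn /=; rewrite normrX ger0_norm // ler_pdivlMr // => h.
by apply: le_trans h; rewrite ler_wpM2l ?exprn_ge0 // lerDl.
Qed.

Lemma contraction_fixed_point (F : H -> H) (q : R) : 0 <= q < 1 ->
  (forall x z, rnorm (F x - F z) <= q * rnorm (x - z)) -> exists l, F l = l.
Proof.
move=> q01 hF; have /andP[q0 q1] := q01.
(* Two points with small residuals are close to each other, and the residuals of the iterates decay
   like q^n; so the iterates form a Cauchy sequence. *)
have key x z : rnorm (x - z) * (1 - q) <= rnorm (x - F x) + rnorm (z - F z).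
  have := hF x z; have -> : x - z = (x - F x) + (F x - F z) + (F z - z).
    by rewrite !subrKA.
  rewrite (rnorm_distC z); have := rnormD (x - F x + (F x - F z)) (F z - z).
  have := rnormD (x - F x) (F x - F z); nra.
pose u n := iter n F 0.
have hu n : rnorm (u n - F (u n)) <= q ^+ n * rnorm (u 0%N - F (u 0%N)).
  elim: n => [|n IH]; first by rewrite mul1r.
  rewrite exprS -mulrA; apply: le_trans (hF (u n) (F (u n))) _.
  by rewrite ler_wpM2l.
have q1' : 0 < 1 - q by rewrite subr_gt0.
have [l hl] : exists l, forall e : R, 0 < e -> exists n, forall m, (n <= m)%N ->
     rnorm (u m - l) <= e.
  apply: rnorm_cauchy_limit => e e0.
  have [n hn] := geometric_small q01 (rnorm_ge0 (u 0%N - F (u 0%N)))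
    (divr_gt0 (mulr_gt0 e0 q1') (ltr0n R 2)).
  exists n => m k nm nk; rewrite -(ler_pM2r q1').
  apply: le_trans (key _ _) _; rewrite [leRHS](splitr (e * (1 - q))).
  by apply: lerD; apply: le_trans (hu _) _; exact: hn.
exists l; apply/eqP; rewrite -subr_eq0; apply/eqP/rnorm0_eq0/eqP.
rewrite eq_le rnorm_ge0 andbT; apply: (@le_of_add_eps _ _ _ 3) => e e0.
have [n hn] := hl _ e0.
have [k hk] := geometric_small q01 (rnorm_ge0 (u 0%N - F (u 0%N))) e0.
pose m := maxn n k; have nm := leq_maxl n k; have km := leq_maxr n k.
have h1 := hn m nm; have h2 := le_trans (hu m) (hk m km).
have h3 : rnorm (F l - F (u m)) <= e.
  apply: le_trans (hF _ _) _; rewrite rnorm_distC; apply: le_trans h1.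
  by rewrite ler_piMl ?rnorm_ge0 // ltW.
have -> : F l - l = (F l - F (u m)) - (u m - F (u m)) + (u m - l).
  by rewrite opprB !subrKA.
have := rnormD (F l - F (u m) - (u m - F (u m))) (u m - l).
have := rnormB (F l - F (u m)) (u m - F (u m)).
rewrite add0r; lra.
Qed.

(** For [C x = A x - l *: x] this is convertible to the existential negated in [spectrum A l]. *)
Definition invertible_op (C : H -> H) := exists S : H -> H,
  [/\ bounded_op S, forall x, S (C x) = x & forall x, C (S x) = x].

(** Coercivity bounds [C] from below, which yields injectivity and the bound [c^-1] on the inverse.
    Surjectivity is a fixed point problem: solutions of C x = y are the fixed points of x - tau (C x
    - y). *)
Lemma lax_milgram C (c : R) : bounded_op C -> 0 < c ->
  (forall x, c * rnorm x ^+ 2 <= rip (C x) x) -> invertible_op C.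
Proof.
move=> bC c0 hC; have linC := bounded_op_linear bC.
have [K0 [K00 hK0]] := bounded_op_ub bC.
(* Adding [c] to the bound gives both K > 0 and c <= K, so that the contraction factor below is a
   real square root. *)
pose K := K0 + c.
have K_gt0 : 0 < K by rewrite ltr_wpDl.
have cK : c <= K by rewrite lerDr.
have hK x : rnorm (C x) <= K * rnorm x.
  by apply: le_trans (hK0 x) _; rewrite ler_wpM2r ?rnorm_ge0 // lerDl ltW.
have lower x : c * rnorm x <= rnorm (C x).
  have [x0|xn0] := eqVneq (rnorm x) 0; first by rewrite x0 mulr0 rnorm_ge0.
  have x0 : 0 < rnorm x by rewrite lt_neqAle eq_sym xn0 rnorm_ge0.
  rewrite -(ler_pM2r x0) -mulrA -expr2; apply: le_trans (hC x) _.
  exact: rip_le.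
have surj y : exists x, C x = y.
  (* This value minimizes 1 - 2 tau c + tau^2 K^2, the bound on the squared contraction factor; the
     minimum is 1 - c^2 / K^2. *)
  pose tau := c / K ^+ 2.
  have tau0 : 0 < tau by rewrite divr_gt0 // exprn_gt0.
  pose q := Num.sqrt (1 - c ^+ 2 / K ^+ 2).
  have q2 : 0 <= 1 - c ^+ 2 / K ^+ 2 < 1.
    rewrite subr_ge0 ler_pdivrMr ?exprn_gt0 // mul1r.
    rewrite ler_sqr ?nnegrE ?(ltW c0) ?(ltW K_gt0) //.
    by rewrite cK /= ltrBlDr ltrDl divr_gt0 ?exprn_gt0.
  have q01 : 0 <= q < 1.
    rewrite sqrtr_ge0 /= -[ltRHS]sqrtr1 ltr_sqrt ?ltr01 //.
    by case/andP: q2.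
  have [|l hl] := @contraction_fixed_point (fun x => x - tau%:C *: (C x - y)) q q01.
    move=> x z.
    have -> : x - tau%:C *: (C x - y) - (z - tau%:C *: (C z - y)) =
       (x - z) - tau%:C *: C (x - z).
      rewrite (linear_propB linC) !scalerBr !opprB -!addrA; congr (_ + _).
      rewrite [in RHS]addrC -!addrA [LHS]addrC -!addrA.
      rewrite [in LHS]addrCA; congr (_ + _).
      by rewrite [- z + _]addrC addKr.
    rewrite -ler_sqr ?nnegrE ?rnorm_ge0 ?mulr_ge0 ?rnorm_ge0 ?sqrtr_ge0 //.
    rewrite exprMn sqr_sqrtr; last by case/andP: q2.
    rewrite (rnorm_sqrB ip_norm) ripZr ripC rnormZ rnorm_real exprMn.
    rewrite real_normK ?num_real //.
    have h1 := hC (x - z).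
    have h2 : rnorm (C (x - z)) ^+ 2 <= K ^+ 2 * rnorm (x - z) ^+ 2.
      rewrite -exprMn ler_sqr ?nnegrE ?rnorm_ge0 ?mulr_ge0 ?rnorm_ge0 ?(ltW K_gt0) //.
    have h3 : tau ^+ 2 * rnorm (C (x - z)) ^+ 2 <=
       tau ^+ 2 * (K ^+ 2 * rnorm (x - z) ^+ 2) by rewrite ler_wpM2l ?sqr_ge0.
    have h4 : tau * (c * rnorm (x - z) ^+ 2) <= tau * rip (C (x - z)) (x - z).
      by rewrite ler_pM2l.
    have -> : (1 - c ^+ 2 / K ^+ 2) * rnorm (x - z) ^+ 2 =
       rnorm (x - z) ^+ 2 + tau ^+ 2 * (K ^+ 2 * rnorm (x - z) ^+ 2)
       - 2 * (tau * (c * rnorm (x - z) ^+ 2)).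
      by rewrite /tau; field; rewrite gt_eqF.
    lra.
  exists l; move/eqP: hl; rewrite -subr_eq0 addrAC subrr sub0r oppr_eq0.
  rewrite scaler_eq0 subr_eq0 => /orP[/eqP /complexI t0|/eqP//].
  by rewrite t0 ltxx in tau0.
have inj x z : C x = C z -> x = z.
  move=> xz; apply/eqP; rewrite -subr_eq0; apply/eqP/rnorm0_eq0/eqP.
  rewrite eq_le rnorm_ge0 andbT -(ler_pM2l c0) mulr0.
  by apply: le_trans (lower _) _; rewrite (linear_propB linC) xz subrr rnorm0.
have [S hS] := choice surj.
exists S; split => //; last by move=> x; apply: inj; rewrite hS.
apply/bounded_opP; split.
  by move=> a x z; apply: inj; rewrite hS (linear_propD linC) (linear_propZ linC) !hS.
exists c^-1; split; first by rewrite invr_ge0 ltW.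
move=> x; rewrite -(ler_pM2l c0) mulVKf ?gt_eqF //.
by apply: le_trans (lower _) _; rewrite hS.
Qed.

(* The representing vector is the limit of a maximizing sequence of
   J x = 2 Re (phi x) - |x|^2, which is Cauchy by the parallelogram law. *)
Lemma riesz_representation (phi : H -> R[i]) (K : R) :
  (forall a x y, phi (a *: x + y) = a * phi x + phi y) ->
  (forall x, rnorm (phi x) <= K * rnorm x) ->
  exists y, forall x, phi x = ip x y.
Proof.
move=> lphi bphi.
pose rphi x := complex.Re (phi x).
have rphiD r x y : rphi (r%:C *: x + y) = r * rphi x + rphi y.
  by rewrite /rphi lphi ReD ReZ.
pose J x := 2 * rphi x - rnorm x ^+ 2.
have J_ub x : J x <= K ^+ 2.
  have := le_trans (Re_le_rnorm (phi x)) (bphi x); rewrite -/(rphi x) /J => h.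
  have := sqr_ge0 (K - rnorm x); nra.
pose s := sup (range J).
have hsup : has_sup (range J).
  by split; [exists (J 0), 0 | exists (K ^+ 2) => _ [x _ <-]].
have Js x : J x <= s by apply: sup_upper_bound => //; exists x.
have ex (n : nat) : exists x, s - (n.+1%:R)^-1 <= J x.
  have [|_ [x _ <-] h] := @sup_adherent _ _ (n.+1%:R^-1) _ hsup.
    by rewrite invr_gt0 ltr0n.
  by exists x; exact: ltW.
have [u hu] := choice ex.
have [l hl] : exists l, forall e : R, 0 < e -> exists n, forall m, (n <= m)%N ->
     rnorm (u m - l) <= e.
  apply: rnorm_cauchy_limit => e e0.
  pose d := e ^+ 2 / 4; have d0 : 0 < d by rewrite divr_gt0 ?exprn_gt0.
  have [n nd] := invS_le d0.
  exists n => m k nm nk.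
  rewrite -ler_sqr ?nnegrE ?rnorm_ge0 ?(ltW e0) //.
  (* At the midpoint [J] exceeds the mean of its two values by |u m - u k|^2 / 4. Both values are at
     least s - d, so |u m - u k|^2 <= 4 d = e^2. *)
  have := Js ((2^-1)%:C *: u m + (2^-1)%:C *: u k).
  have := le_trans (lerB (lexx s) (nd m nm)) (hu m).
  have := le_trans (lerB (lexx s) (nd k nk)) (hu k).
  rewrite /J (rnorm_sqrB ip_norm) (rnorm_sqrD ip_norm) rphiD.
  rewrite -[(2^-1)%:C *: u k]addr0 rphiD.
  have -> : rphi 0 = 0.
    have := rphiD (-1) 0 0; rewrite scaler0 addr0; lra.
  rewrite addr0 !rnormZ rnorm_real ripZl ripZr ger0_norm ?invr_ge0 //.
  rewrite !exprMn.
  have -> : e ^+ 2 = 4 * d by rewrite /d; field.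
  have -> : (2^-1 : R) ^+ 2 = 4^-1 by field.
  set A := rnorm (u m) ^+ 2; set B := rnorm (u k) ^+ 2.
  lra.
have main v : rphi v = rip v l.
  suff : 2 * (rphi v - rip v l) = 0 by lra.
  apply: (@real_linear_form_eq0 _ _ (rnorm v ^+ 2)); first exact: sqr_ge0.
  (* First variation at the maximum: [J] is tested at [u m] moved by t v, and [u m] is then replaced
     by its limit [l] at the cost of a multiple of [e]. *)
  move=> t; apply: (@le_of_add_eps _ _ _ (1 + 2 * (`|t| * rnorm v))) => e e0.
  have [n hn] := hl e e0.
  have [k hk] := invS_le e0.
  pose m := maxn n k; have me := hk m (leq_maxr _ _).
  have h1 := hn m (leq_maxl _ _).
  have h2 := Js (t%:C *: v + u m).
  have h3 := le_trans (lerB (lexx s) me) (hu m).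
  have h4 : t * (rip v (u m) - rip v l) <= `|t| * rnorm v * e.
    rewrite -ripBr -ripZl; apply: le_trans (rip_le ip_norm _ _) _.
    by rewrite rnormZ rnorm_real ler_wpM2l ?mulr_ge0 ?rnorm_ge0.
  move: h2 h3; rewrite /J rphiD (rnorm_sqrD ip_norm) ripZl rnormZ rnorm_real.
  rewrite exprMn real_normK ?num_real //.
  move: h4; set X := `|t| * rnorm v; nra.
exists l => x; apply/eqP; rewrite eq_complex; apply/andP; split.
  by apply/eqP; exact: main.
(* The real part at i x carries the imaginary part at x. *)
have := main ('i%C *: x).
rewrite /rphi -[_ *: x]addr0 lphi addr0 /re_ip ipZl.
have -> : phi 0 = 0.
  by have := lphi (-1) 0 0; rewrite scaler0 addr0 mulN1r addNr.
rewrite addr0 !(mulrC 'i%C) !ReiNIm => /oppr_inj ->.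
by rewrite eqxx.
Qed.

Lemma ip_ext y z : (forall x, ip x y = ip x z) -> y = z.
Proof.
move=> yz; apply/eqP; rewrite -subr_eq0; apply/eqP/rnorm0_eq0/eqP.
by rewrite -sqrf_eq0 -(rip_rnorm ip_norm) /re_ip ipBr yz subrr.
Qed.

Lemma adjointP T : bounded_op T ->
  forall x y, ip (T x) y = ip x (adjoint ip T y).
Proof.
move=> bT; have linT := bounded_op_linear bT.
have [K [K0 hK]] := bounded_op_ub bT.
suff : exists S, forall x y, ip (T x) y = ip x (S y).
  by move=> ex; apply: (xgetPex 0 ex).
suff /choice[S hS] : forall y, exists z, forall x, ip (T x) y = ip x z by exists S.
move=> y.
apply: (@riesz_representation _ (K * rnorm y)).
  by move=> a x z; rewrite linT ipDl ipZl.
move=> x; apply: le_trans (cauchy_schwarz ip_norm _ _) _.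
by rewrite mulrAC ler_wpM2r ?rnorm_ge0.
Qed.

(** With z the image of y under the adjoint, |z|^2 = Re <T z, y> <= K |z| |y|. *)
Lemma bounded_by_adjoint T K : bounded_op T -> bounded_by K T ->
  bounded_by K (adjoint ip T).
Proof.
move=> bT [K0 hK]; split => // y; set z := adjoint ip T y.
have [z0|zn0] := eqVneq (rnorm z) 0; first by rewrite z0 mulr_ge0 ?rnorm_ge0.
have z0 : 0 < rnorm z by rewrite lt_neqAle eq_sym zn0 rnorm_ge0.
rewrite -(ler_pM2r z0) -expr2 -(rip_rnorm ip_norm) /re_ip -adjointP //.
apply: le_trans (rip_le ip_norm _ _) _.
by rewrite mulrAC ler_wpM2r ?rnorm_ge0.
Qed.

Lemma adjoint_bounded T : bounded_op T -> bounded_op (adjoint ip T).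
Proof.
move=> bT; have [K hK] := bounded_op_ub bT.
apply/bounded_opP; split; last by exists K; exact: bounded_by_adjoint.
move=> a y z; apply: ip_ext => x.
rewrite -adjointP // linearDr /= [in RHS]linearDr /=.
by rewrite !ipZr -!adjointP.
Qed.

Lemma adjointK T : bounded_op T -> adjoint ip (adjoint ip T) = T.
Proof.
move=> bT; apply/funext => y; apply: ip_ext => x.
by rewrite -adjointP; [rewrite ipC -adjointP // ipC conjCK | exact: adjoint_bounded].
Qed.

End HilbertTheory.

(** * Polynomials of operators and the spectral bound *)

Section PolynomialCalculus.
Variables (R : realType) (H : completeNormedModType R[i]).
Implicit Types (x y : H) (A B S T : H -> H) (p q : {poly R[i]}).

Lemma invertible_op_comp S T :
  invertible_op S -> invertible_op T -> invertible_op (S \o T).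
Proof.
move=> [S' [bS' S'S SS']] [T' [bT' T'T TT']]; exists (T' \o S'); split.
- exact: bounded_op_comp.
- by move=> x /=; rewrite S'S T'T.
- by move=> x /=; rewrite TT' SS'.
Qed.

Lemma invertible_opZ (a : R[i]) : a != 0 -> invertible_op (fun x : H => a *: x).
Proof.
move=> a0; exists (a^-1 *: @id H); split.
- exact/bounded_opZ/bounded_op_id.
- by move=> x; rewrite -[LHS]/(_ *: (_ *: _)) scalerA mulVf // scale1r.
- by move=> x; rewrite -[LHS]/(_ *: (_ *: _)) scalerA divff // scale1r.
Qed.

(** Complex coefficients, because invertibility is read off a factorization into linear factors. *)
Definition cpoly_op p A x : H := \sum_(i < size p) p`_i *: iter i A x.

Lemma cpoly_op_widen p A x n : (size p <= n)%N ->
  cpoly_op p A x = \sum_(i < n) p`_i *: iter i A x.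
Proof.
move=> pn; rewrite /cpoly_op (big_ord_widen n (fun i => p`_i *: iter i A x)) //.
rewrite big_mkcond /=; apply: eq_bigr => i _; case: ltnP => // ip.
by rewrite nth_default // scale0r.
Qed.

Lemma cpoly_opD p q A x :
  cpoly_op (p + q) A x = cpoly_op p A x + cpoly_op q A x.
Proof.
rewrite (cpoly_op_widen _ _ (size_polyD p q)).
rewrite (cpoly_op_widen A x (leq_maxl (size p) (size q))).
rewrite (cpoly_op_widen A x (leq_maxr (size p) (size q))).
by rewrite -big_split; apply: eq_bigr => i _; rewrite coefD scalerDl.
Qed.

Lemma cpoly_opZ a p A x : cpoly_op (a *: p) A x = a *: cpoly_op p A x.
Proof.
rewrite (cpoly_op_widen _ _ (size_scale_leq a p)) scaler_sumr.
by apply: eq_bigr => i _; rewrite coefZ scalerA.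
Qed.

Lemma cpoly_opC a A x : cpoly_op a%:P A x = a *: x.
Proof.
rewrite (cpoly_op_widen _ _ (size_polyC_leq1 a)).
by rewrite big_ord1 coefC eqxx.
Qed.

Lemma cpoly_opMX p A x : cpoly_op (p * 'X) A x = cpoly_op p A (A x).
Proof.
have pX : (size (p * 'X)%R <= (size p).+1)%N.
  have [->|p0] := eqVneq p 0; first by rewrite mul0r size_poly0.
  by rewrite size_mulX.
rewrite (cpoly_op_widen _ _ pX) big_ord_recl coefMX eqxx scale0r add0r.
by apply: eq_bigr => i _; rewrite coefMX /= -iterSr.
Qed.

Lemma cpoly_opM p q A x : linear A ->
  cpoly_op (p * q) A x = cpoly_op p A (cpoly_op q A x).
Proof.
move=> linA; have comm y : cpoly_op q A (A y) = A (cpoly_op q A y).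
  rewrite /cpoly_op (linear_prop_sum linA); apply: eq_bigr => i _.
  by rewrite (linear_propZ linA) -iterSr.
elim/poly_ind: p x => [|p c IH] x.
  by rewrite mul0r -polyC0 !cpoly_opC !scale0r.
rewrite mulrDl mulrAC !cpoly_opD !cpoly_opMX IH comm; congr (_ + _).
by rewrite mul_polyC cpoly_opZ cpoly_opC.
Qed.

Lemma cpoly_op_bounded p A : bounded_op A -> bounded_op (cpoly_op p A).
Proof.
move=> bA; elim/poly_ind: p => [|p c IH].
  have -> : cpoly_op 0 A = 0 *: @id H.
    by apply/funext => x; rewrite -polyC0 cpoly_opC.
  exact/bounded_opZ/bounded_op_id.
have -> : cpoly_op (p * 'X + c%:P) A = (cpoly_op p A \o A) + c *: @id H.
  by apply/funext => x; rewrite cpoly_opD cpoly_opMX cpoly_opC.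
apply: bounded_opD; last exact/bounded_opZ/bounded_op_id.
exact: bounded_op_comp.
Qed.

(** Each linear factor of [p] gives an invertible operator, and these compose. This is half of
    spectral mapping: 0 enters the spectrum of p(A) only through a root of [p] in the spectrum of
    [A]. *)
Lemma cpoly_op_invertible p A : bounded_op A -> p != 0 ->
  (forall z, root p z -> invertible_op (fun x => A x - z *: x)) ->
  invertible_op (cpoly_op p A).
Proof.
move=> bA; have linA := bounded_op_linear bA.
have [rs ->] := closed_field_poly_normal p.
set c := lead_coef p => cp0.
have c0 : c != 0 by apply: contraNneq cp0 => ->; rewrite scale0r.
move=> hr.
have -> : cpoly_op (c *: \prod_(z <- rs) ('X - z%:P)) A =
    (fun x => c *: x) \o cpoly_op (\prod_(z <- rs) ('X - z%:P)) A.
  by apply/funext => x /=; rewrite cpoly_opZ.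
apply: invertible_op_comp; first exact: invertible_opZ.
have {}hr z : z \in rs -> invertible_op (fun x => A x - z *: x).
  by move=> zr; apply: hr; rewrite rootZ // root_prod_XsubC.
elim: rs hr {cp0} => [|z rs IH] hr.
  rewrite big_nil; have -> : cpoly_op 1 A = fun x => 1 *: x.
    by apply/funext => x; rewrite -polyC1 cpoly_opC.
  exact/invertible_opZ/oner_neq0.
rewrite big_cons.
have -> : cpoly_op (('X - z%:P) * \prod_(j <- rs) ('X - j%:P)) A =
   (fun x => A x - z *: x) \o cpoly_op (\prod_(j <- rs) ('X - j%:P)) A.
  apply/funext => x /=; rewrite cpoly_opM // -polyCN cpoly_opD cpoly_opC scaleNr.
  by rewrite -[X in cpoly_op X]mul1r cpoly_opMX -polyC1 cpoly_opC scale1r.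
apply: invertible_op_comp; first by apply: hr; rewrite mem_head.
by apply: IH => j jr; apply: hr; rewrite inE jr orbT.
Qed.

Lemma poly_opE (p : {poly R}) A :
  poly_op p A = cpoly_op (map_poly (real_complex R) p) A.
Proof.
apply/funext => x; rewrite /poly_op /cpoly_op size_map_poly.
by apply: eq_bigr => i _; rewrite coef_map.
Qed.

Lemma poly_op_bounded (p : {poly R}) A : bounded_op A -> bounded_op (poly_op p A).
Proof. by move=> bA; rewrite poly_opE; exact: cpoly_op_bounded. Qed.

Lemma poly_opB (p q : {poly R}) A x :
  poly_op (p - q) A x = poly_op p A x - poly_op q A x.
Proof.
rewrite !poly_opE rmorphB /= cpoly_opD -[- map_poly _ q]scaleN1r cpoly_opZ.
by rewrite scaleN1r.
Qed.

Lemma poly_opM (p q : {poly R}) A x : linear A ->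
  poly_op (p * q) A x = poly_op p A (poly_op q A x).
Proof. by move=> linA; rewrite !poly_opE rmorphM /= cpoly_opM. Qed.

Lemma poly_opC (c : R) A x : poly_op c%:P A x = c%:C *: x.
Proof. by rewrite poly_opE map_polyC /= cpoly_opC. Qed.

Lemma poly_opX A x : poly_op 'X A x = A x.
Proof.
rewrite poly_opE map_polyX -['X]mul1r cpoly_opMX -polyC1 cpoly_opC.
exact: scale1r.
Qed.

Lemma poly_op_intertwine (p : {poly R}) A B T : linear T ->
  (forall x, T (A x) = B (T x)) ->
  forall x, T (poly_op p A x) = poly_op p B (T x).
Proof.
move=> linT AB x; rewrite /poly_op (linear_prop_sum linT); apply: eq_bigr => i _.
rewrite (linear_propZ linT); congr (_ *: _).
by elim: (i : nat) => //= n <-; rewrite AB.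
Qed.
End PolynomialCalculus.

(** * Self-adjoint operators and the norm of p(A) *)

Section SpectralBound.
Variables (R : realType) (H : completeNormedModType R[i]).
Variable ip : {dot H for @Num.conj R[i]}.
Hypothesis ip_norm : induces_norm ip.
Implicit Types (x y : H) (a : R[i]) (r t : R) (S T A B : H -> H).
Local Notation rip := (re_ip ip).

Definition self_adjoint A := forall x y, ip (A x) y = ip x (A y).

Lemma self_adjoint_Im A x : self_adjoint A -> complex.Im (ip (A x) x) = 0.
Proof.
move=> sA; have : ip (A x) x = Num.conj (ip (A x) x) by rewrite -ipC sA.
by move/esym/eqP; rewrite -CrealE => /complex_realP[k ->].
Qed.

Lemma poly_op_self_adjoint (p : {poly R}) A : self_adjoint A ->
  self_adjoint (poly_op p A).
Proof.
move=> sA x y; rewrite /poly_op linear_sumlz linear_sumr; apply: eq_bigr => i _ /=.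
rewrite ipZl ipZr conj_Creal; last by apply/complex_realP; exists p`_i.
congr (_ * _); elim: (i : nat) x y => //= n IH x y.
by rewrite sA IH -iterSr.
Qed.

Lemma nonreal_invertible A a : bounded_op A -> self_adjoint A ->
  complex.Im a != 0 -> invertible_op (fun x => A x - a *: x).
Proof.
move=> bA sA a0; set b := complex.Im a.
(* As <A x, x> is real, multiplication by i b makes its contribution imaginary, and what remains of
   the real part is b^2 |x|^2: the product is coercive. *)
pose w : R[i] := 'i%C * b%:C.
have w0 : w != 0.
  rewrite mulf_neq0 //; first by rewrite eq_complex /= oner_eq0 andbF.
  by apply: contraNneq a0 => b0; apply/eqP; exact: complexI b0.
have bAa : bounded_op (fun x => A x - a *: x).
  have -> : (fun x => A x - a *: x) = A + (- a) *: @id H.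
    by apply/funext => x; rewrite -[RHS]/(_ + _ *: _) scaleNr.
  apply: bounded_opD => //; exact/bounded_opZ/bounded_op_id.
have inv : invertible_op (w *: (fun x => A x - a *: x)).
  apply: (lax_milgram ip_norm _ (c := b ^+ 2)).
  - exact: bounded_opZ.
  - by rewrite exprn_even_gt0.
  move=> x; rewrite -[(_ *: _) x]/(w *: (A x - a *: x)) /re_ip ipZl ipBl ipZl.
  rewrite (ip_rnorm ip_norm) mulrBr ReD ReN.
  have -> : complex.Re (w * ip (A x) x) = 0.
    have := self_adjoint_Im x sA; rewrite /w; case: (ip _ _) => u v /= ->.
    by rewrite !mul0r !mulr0 !subr0 mul0r.
  rewrite /w /b; case: (a) => u v /=; rewrite le_eqVlt; apply/orP; left.
  by apply/eqP; ring.
have -> : (fun x => A x - a *: x) =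
    (fun x => w^-1 *: x) \o (w *: (fun x => A x - a *: x)).
  by apply/funext => x /=; rewrite -[RHS]/(_ *: (_ *: _)) scalerA mulVf // scale1r.
by apply: invertible_op_comp => //; apply: invertible_opZ; rewrite invr_eq0.
Qed.

(** Non-real roots are harmless by [nonreal_invertible], so a condition on the real roots
    suffices. *)
Lemma poly_op_invertible (q : {poly R}) A : bounded_op A -> self_adjoint A ->
  q != 0 -> (forall t, root q t -> ~ spectrum A t%:C) ->
  invertible_op (poly_op q A).
Proof.
move=> bA sA q0 hq; rewrite poly_opE; apply: cpoly_op_invertible => //.
  by rewrite map_poly_eq0.
move=> z; have [z0|z0 _] := eqVneq (complex.Im z) 0; last first.
  exact: nonreal_invertible.
have -> : z = (complex.Re z)%:C by case: z z0 => u v /= ->.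
by rewrite fmorph_root => /hq /contrapT.
Qed.

(* With N = |B|, the operator N^2 - B^2 is not bounded from below:
   |(N^2 - B^2) x|^2 <= N^2 (N^2 |x|^2 - |B x|^2). *)
Lemma opnorm_sqr_not_invertible B : bounded_op B -> self_adjoint B ->
  0 < opnorm B ->
  ~ invertible_op (fun x => B (B x) - (opnorm B ^+ 2)%:C *: x).
Proof.
move=> bB sB; set N := opnorm B => N0 [S [bS SD _]].
have [_ hB] := opnorm_bound bB; rewrite -/N in hB.
have [k [k0 hS]] := bounded_op_ub bS.
have hB2 x : rnorm (B x) ^+ 2 <= N ^+ 2 * rnorm x ^+ 2.
  by rewrite -exprMn ler_sqr ?nnegrE ?rnorm_ge0 ?mulr_ge0 ?rnorm_ge0 ?(ltW N0).
pose D x := B (B x) - (N ^+ 2)%:C *: x.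
have hD x : rnorm (D x) ^+ 2 <= N ^+ 2 * (N ^+ 2 * rnorm x ^+ 2 - rnorm (B x) ^+ 2).
  rewrite /D (rnorm_sqrB ip_norm) ripZr rnormZ rnorm_real.
  have -> : rip (B (B x)) x = rnorm (B x) ^+ 2.
    by rewrite /re_ip sB -/(re_ip ip _ _) (rip_rnorm ip_norm).
  rewrite exprMn real_normK ?num_real //.
  have := hB2 (B x); nra.
(* The first term is the constant obtained from |x| <= k |D x| and [hD]. The second ensures kap > 0
   and kap^-1 <= N^2, so that a square root can be taken below. Then |B| is at most sqrt (N^2 -
   kap^-1) < N, a contradiction. *)
pose kap := k ^+ 2 * N ^+ 2 + (N ^+ 2)^-1.
have N2 : 0 < N ^+ 2 by rewrite exprn_gt0.
have kap0 : 0 < kap.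
  apply: ltr_wpDl; last by rewrite invr_gt0.
  by apply: mulr_ge0; exact: sqr_ge0.
have h x : rnorm (B x) ^+ 2 <= (N ^+ 2 - kap^-1) * rnorm x ^+ 2.
  have hx : rnorm x ^+ 2 <= kap * (N ^+ 2 * rnorm x ^+ 2 - rnorm (B x) ^+ 2).
    rewrite mulrDl; apply: ler_wpDr.
      by rewrite mulr_ge0 ?invr_ge0 ?(ltW N2) // subr_ge0.
    apply: (@le_trans _ _ (k ^+ 2 * rnorm (D x) ^+ 2)).
      rewrite -exprMn ler_sqr ?nnegrE ?rnorm_ge0 ?mulr_ge0 ?rnorm_ge0 //.
      by rewrite -[in leLHS](SD x); exact: hS.
    by rewrite -mulrA ler_wpM2l ?sqr_ge0.
  move: hx; rewrite -ler_pdivrMl // mulrBl => hx; lra.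
have m0 : 0 <= N ^+ 2 - kap^-1.
  rewrite subr_ge0 invf_ple ?posrE // /kap lerDr mulr_ge0 ?sqr_ge0 //.
have : N <= Num.sqrt (N ^+ 2 - kap^-1).
  apply: opnorm_le; split; first exact: sqrtr_ge0.
  move=> x; rewrite -ler_sqr ?nnegrE ?rnorm_ge0 ?mulr_ge0 ?rnorm_ge0 ?sqrtr_ge0 //.
  by rewrite exprMn sqr_sqrtr.
rewrite -ler_sqr ?nnegrE ?sqrtr_ge0 ?(ltW N0) // sqr_sqrtr //.
by rewrite lerBrDl gerDr leNgt invr_gt0 kap0.
Qed.

Lemma spectral_bound_nonconstant (p : {poly R}) A M :
  bounded_op A -> self_adjoint A -> (1 < size p)%N -> 0 <= M ->
  (forall t, spectrum A t%:C -> `|p.[t]| <= M) ->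
  opnorm (poly_op p A) <= M.
Proof.
move=> bA sA p1 M0 hp; rewrite leNgt; apply/negP => MN.
have bB := poly_op_bounded p bA; have sB := poly_op_self_adjoint p sA.
have linA := bounded_op_linear bA.
set B := poly_op p A in MN bB sB; set N := opnorm B in MN.
have N0 : 0 < N by apply: le_lt_trans MN.
have inv s : `|s| = N -> invertible_op (poly_op (p - s%:P) A).
  move=> sN; apply: poly_op_invertible => //.
    (* A polynomial of size above 1 differs from every constant. *)
    rewrite subr_eq0; apply: contraTneq p1 => ->.
    by rewrite -leqNgt size_polyC_leq1.
  move=> t; rewrite rootE !hornerE subr_eq0 => /eqP pt /hp.
  by rewrite pt sN leNgt MN.
apply: (opnorm_sqr_not_invertible bB sB N0).
have -> : (fun x => B (B x) - (opnorm B ^+ 2)%:C *: x) =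
    poly_op (p - N%:P) A \o poly_op (p - (- N)%:P) A.
  apply/funext => x /=; rewrite -poly_opM //.
  have -> : (p - N%:P) * (p - (- N)%:P) = p * p - (N ^+ 2)%:P.
    by rewrite rmorphN /= rmorphXn /=; ring.
  by rewrite poly_opB poly_opM // poly_opC.
by apply: invertible_op_comp; apply: inv; rewrite ?normrN gtr0_norm.
Qed.

(** For a constant [p] a point of the spectrum is needed. If there is none, the nonconstant case
    with p = X and M = 0 forces A = 0; since 0 is not in the spectrum either, the zero map is
    invertible and [H] is trivial. *)
Lemma spectral_bound (p : {poly R}) A M :
  bounded_op A -> self_adjoint A -> 0 <= M ->
  (forall t, spectrum A t%:C -> `|p.[t]| <= M) ->
  forall x, rnorm (poly_op p A x) <= M * rnorm x.
Proof.
move=> bA sA M0 hp x; have [p1|p1] := ltnP 1 (size p).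
  have [_ hB] := opnorm_bound (poly_op_bounded p bA).
  apply: le_trans (hB x) _; rewrite ler_wpM2r ?rnorm_ge0 //.
  exact: spectral_bound_nonconstant.
rewrite (size1_polyC p1) poly_opC rnormZ rnorm_real.
have [[t st]|nt] := pselect (exists t, spectrum A t%:C).
  rewrite ler_wpM2r ?rnorm_ge0 //; have := hp t st.
  by rewrite [in X in X -> _](size1_polyC p1) hornerC.
have nt0 t : ~ spectrum A t%:C by move=> st; apply: nt; exists t.
have A0 y : A y = 0.
  apply/rnorm0_eq0/eqP; rewrite eq_le rnorm_ge0 andbT.
  rewrite -poly_opX -[leRHS](mul0r (rnorm y)).
  have [_ hB] := opnorm_bound (poly_op_bounded 'X bA).
  apply: le_trans (hB y) _; rewrite ler_wpM2r ?rnorm_ge0 //.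
  apply: spectral_bound_nonconstant => //; first by rewrite size_polyX.
  by move=> t /nt0.
have /contrapT[S [bS + _]] := nt0 0.
move=> /(_ x); rewrite A0 scale0r subr0 (linear_prop0 (bounded_op_linear bS)) => <-.
by rewrite rnorm0 !mulr0.
Qed.
End SpectralBound.

(** * Continuous functional calculus *)

Lemma uniform_cvgP (R : realType) (D : set R) (u : nat -> R -> R) (f : R -> R) :
  {uniform D, u @ \oo --> f} <->
  forall e : R, 0 < e ->
    \forall n \near \oo, forall t, D t -> `|u n t - f t| <= e.
Proof.
split=> [uf e e0|uf P].
  apply: (uf [set h | forall t, D t -> `|h t - f t| <= e]); apply/uniform_nbhs.
  exists [set xy | ball xy.1 e xy.2]; split.
    by rewrite -entourage_ballE; exists e.
  by move=> h /= hf t Dt; rewrite distrC; apply: ltW; exact: hf.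
move=> /uniform_nbhs[E [+ EP]]; rewrite -entourage_ballE => -[e /= e0 eE].
have e20 : 0 < e / 2 by rewrite divr_gt0.
have := uf _ e20; apply: filterS => n hn; apply: EP => t Dt; apply: eE => /=.
rewrite -ball_normE /= distrC; apply: le_lt_trans (hn t Dt) _.
by rewrite ltr_pdivrMr // ltr_pMr // ltr1n.
Qed.

Lemma within_continuous_bounded (R : realType) (f : R -> R) (M : R) :
  {within `[0, +oo[, continuous f} ->
  exists2 F, 0 <= F & forall t, 0 <= t <= M -> `|f t| <= F.
Proof.
move=> /within_continuous_normr cf.
have [C C0 hC] := quadratic_modulus M cf ltr01.
exists (`|f 0| + (1 + C * M ^+ 2)).
  by rewrite addr_ge0 // addr_ge0 // mulr_ge0 ?sqr_ge0.
move=> t /andP[t0 tM].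
have M0 : 0 <= M := le_trans t0 tM.
have t0M : 0 <= t <= M by rewrite t0.
have z0M : 0 <= (0 : R) <= M by rewrite lexx.
have h := hC t 0 t0M z0M; rewrite normr0 (ger0_norm t0) in h.
rewrite -[f t](subrK (f 0)) [leRHS]addrC; apply: le_trans (ler_normD _ _) _.
rewrite lerD2r; apply: le_trans h _; rewrite subr0 lerD2l ler_wpM2l //.
by rewrite ler_sqr ?nnegrE.
Qed.

Section ContinuousCalculus.
Variables (R : realType) (H : completeNormedModType R[i]).
Variable ip : {dot H for @Num.conj R[i]}.
Hypothesis ip_norm : induces_norm ip.
Implicit Types (x y : H) (t e d M : R) (S T A B : H -> H) (f g h : R -> R).
Implicit Types (p q : {poly R}).
Local Notation rip := (re_ip ip).

Definition positive_op A :=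
  [/\ bounded_op A, self_adjoint ip A & forall x, 0 <= rip (A x) x].

(** For t < 0 the operator A - t is coercive with constant -t; for t > M the operator t - A is, with
    constant t - M. *)
Lemma positive_spectrum A M t : positive_op A -> bounded_by M A ->
  spectrum A t%:C -> 0 <= t <= M.
Proof.
move=> [bA sA pA] [M0 hM] st; apply/negPn/negP => tM; apply: st.
have bAt (s : R) : bounded_op (A + (- s%:C) *: @id H).
  by apply: bounded_opD => //; exact/bounded_opZ/bounded_op_id.
have E x : (A + (- t%:C) *: @id H) x = A x - t%:C *: x.
  by rewrite -[LHS]/(_ + _ *: _) scaleNr.
move: tM; rewrite negb_and -!ltNge => /orP[t0|tM].
  have [] := @lax_milgram _ _ _ ip_norm _ (- t) (bAt t).
  - by rewrite oppr_gt0.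
  - move=> x; rewrite E ripBl ripZl (rip_rnorm ip_norm) mulNr.
    by rewrite -[leLHS]add0r lerD2r.
  move=> S [bS h1 h2]; exists S; split => // x; by rewrite -E.
have [] := @lax_milgram _ _ _ ip_norm (-1 *: (A + (- t%:C) *: @id H)) (t - M).
- exact/bounded_opZ/bAt.
- by rewrite subr_gt0.
- move=> x; rewrite -[(_ *: _) x]/(-1 *: ((A + (- t%:C) *: @id H) x)) scaleN1r.
  rewrite E ripNl ripBl ripZl (rip_rnorm ip_norm).
  have := le_trans (rip_le ip_norm (A x) x) (ler_wpM2r (rnorm_ge0 x) (hM x)).
  by rewrite -mulrA -expr2; lra.
move=> S [bS h1 h2]; exists (fun x => S (-1 *: x)).
have linS := bounded_op_linear bS.
split.
- have -> : (fun x => S (-1 *: x)) = -1 *: S; last exact: bounded_opZ.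
  by apply/funext => x; rewrite (linear_propZ linS).
- by move=> x; rewrite -E; exact: h1.
- move=> x; have := h2 (- x).
  rewrite -[(_ *: _) _]/(-1 *: ((A + (- t%:C) *: @id H) _)) E !scaleN1r.
  by move/oppr_inj.
Qed.

Lemma spectral_bound_itv A M p d : positive_op A -> bounded_by M A ->
  (forall t, 0 <= t <= M -> `|p.[t]| <= d) ->
  forall x, rnorm (poly_op p A x) <= d * rnorm x.
Proof.
move=> pA hM hp; have [bA sA _] := pA; apply: (spectral_bound ip_norm) => //.
  by apply: le_trans (hp 0 _); rewrite // lexx; case: hM.
by move=> t st; apply: hp; exact: (positive_spectrum pA hM st).
Qed.

(** The values p_n(A) x form a Cauchy sequence for each x. The rate is uniform on the unit ball, so
    the pointwise limit is again bounded and linear, and convergence holds in operator norm. *)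
Lemma is_cfc_exists A f : positive_op A ->
  {within `[0, +oo[, continuous f} -> exists B, is_cfc f A B.
Proof.
move=> pA cf; have [bA sA posA] := pA; have linA := bounded_op_linear bA.
have [M hM] := bounded_op_ub bA.
have M1 : 0 < M + 1 by rewrite ltr_wpDl //; case: hM.
pose eps (n : nat) : R := n.+1%:R^-1.
have eps0 n : 0 < eps n by rewrite invr_gt0 ltr0n.
have /choice[p hp] : forall n : nat, exists p : {poly R},
    forall t, 0 <= t <= M -> `|p.[t] - f t| <= eps n.
  move=> n; have [p hp] := weierstrass_approximation M1 cf (eps0 n).
  exists p => t /andP[t0 tM]; apply: hp; rewrite t0 /=.
  by apply: le_trans tM _; rewrite lerDl.
have hpq n m x : rnorm (poly_op (p n) A x - poly_op (p m) A x) <=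
    (eps n + eps m) * rnorm x.
  rewrite -poly_opB; apply: (spectral_bound_itv pA hM) => t t0M.
  rewrite hornerD hornerN -[(p n).[t]](subrK (f t)) -addrA.
  apply: le_trans (ler_normD _ _) _; apply: lerD; first exact: hp.
  by rewrite distrC; exact: hp.
have /choice[B hB] : forall x, exists l, forall e : R, 0 < e ->
    exists n, forall m, (n <= m)%N -> rnorm (poly_op (p m) A x - l) <= e.
  move=> x; apply: rnorm_cauchy_limit => e e0.
  have x1 : 0 < 2 * (rnorm x + 1) by rewrite mulr_gt0 // ltr_wpDl ?rnorm_ge0.
  have [n hn] := invS_le (divr_gt0 e0 x1).
  exists n => m k nm nk; apply: le_trans (hpq _ _ _) _.
  apply: (@le_trans _ _ ((e / (2 * (rnorm x + 1)) + e / (2 * (rnorm x + 1)))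
    * (rnorm x + 1))).
    apply: ler_pM; rewrite ?rnorm_ge0 ?addr_ge0 ?(ltW (eps0 _)) ?lerDl //.
    by apply: lerD; exact: hn.
  rewrite le_eqVlt; apply/orP; left; apply/eqP; field.
  by have := rnorm_ge0 x; lra.
(* Obtained from [hpq] by letting the second index tend to infinity. *)
have hpB n x : rnorm (poly_op (p n) A x - B x) <= eps n * rnorm x.
  apply: (@le_of_add_eps _ _ _ (rnorm x + 1)) => e e0.
  have [n1 hn1] := invS_le e0; have [n2 hn2] := hB x e e0.
  pose m := maxn n1 n2.
  have h1 := hn1 m (leq_maxl _ _); have h2 := hn2 m (leq_maxr _ _).
  rewrite -[poly_op (p n) A x](subrK (poly_op (p m) A x)) -addrA.
  apply: le_trans (rnormD _ _) _; have := hpq n m x.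
  have := ler_wpM2r (rnorm_ge0 x) h1; rewrite -/(eps m) mulrDl; lra.
have lp n := bounded_op_linear (poly_op_bounded (p n) bA).
have bB : bounded_op B.
  apply/bounded_opP; split.
    move=> a x y; apply/eqP; rewrite -subr_eq0; apply/eqP/rnorm0_eq0/eqP.
    rewrite eq_le rnorm_ge0 andbT.
    apply: (@le_of_add_eps _ _ _
      (rnorm (a *: x + y) + rnorm a * rnorm x + rnorm y)) => e e0.
    have [n hn] := invS_le e0; have {}hn := hn n (leqnn n).
    have -> : B (a *: x + y) - (a *: B x + B y) =
      - (poly_op (p n) A (a *: x + y) - B (a *: x + y)) +
      (a *: (poly_op (p n) A x - B x) + (poly_op (p n) A y - B y)).
      rewrite (lp n) scalerBr opprB.
      by rewrite [X in _ = _ + X]addrACA -opprD subrKA.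
    apply: le_trans (rnormD _ _) _; rewrite rnormN.
    have := rnormD (a *: (poly_op (p n) A x - B x)) (poly_op (p n) A y - B y).
    rewrite rnormZ.
    have := hpB n (a *: x + y); have := hpB n y.
    have := ler_wpM2l (rnorm_ge0 a) (hpB n x).
    have := ler_wpM2r (rnorm_ge0 (a *: x + y)) hn.
    have := ler_wpM2r (rnorm_ge0 y) hn.
    have := ler_wpM2r (mulr_ge0 (rnorm_ge0 a) (rnorm_ge0 x)) hn.
    rewrite -/(eps n); lra.
  have [K [K0 hK]] := bounded_op_ub (poly_op_bounded (p 0%N) bA).
  exists (K + 1); split; first by rewrite addr_ge0.
  move=> x; rewrite -[B x](subKr (poly_op (p 0%N) A x)).
  apply: le_trans (rnormB _ _) _; rewrite mulrDl; apply: lerD => //.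
  by apply: le_trans (hpB _ _) _; rewrite /eps invr1.
exists B; split => //; exists p; split.
  apply/uniform_cvgP => e e0; have [n hn] := invS_le e0.
  exists n => // m /= nm t st; apply: le_trans (hn m nm).
  by apply: hp; exact: positive_spectrum st.
apply/cvgr0Pnorm_le => e e0; have [n hn] := invS_le e0.
exists n => // m /= nm; apply: le_trans (hn m nm).
have hb : bounded_by (eps m) (poly_op (p m) A - B).
  split; first exact: ltW.
  by move=> x; exact: hpB.
rewrite ger0_norm; first exact: opnorm_le.
by have [] := opnorm_bound (bounded_opB (poly_op_bounded (p m) bA) bB).
Qed.

Section Cfc.
Variables (A : H -> H) (M : R).
Hypotheses (posA : positive_op A) (AM : bounded_by M A).

Lemma is_cfc_cfc f : {within `[0, +oo[, continuous f} -> is_cfc f A (cfc f A).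
Proof.
move=> cf; have ex := is_cfc_exists posA cf.
exact: (@xgetPex _ 0 [set B | is_cfc f A B] ex).
Qed.

Lemma cfc_bounded f : {within `[0, +oo[, continuous f} -> bounded_op (cfc f A).
Proof.
by case/is_cfc_cfc.
Qed.

(** The sequence provided by [is_cfc] is arbitrary and controlled on the spectrum only. There it
    differs from [p] by at most d + e, and the spectral bound carries this over to [A]. The case d =
    0 shows that the chosen operator depends on no choice. *)
Lemma cfcP f p d : {within `[0, +oo[, continuous f} ->
  (forall t, 0 <= t <= M -> `|p.[t] - f t| <= d) ->
  forall x, rnorm (poly_op p A x - cfc f A x) <= d * rnorm x.
Proof.
move=> cf hp x.
have [bB [u [/uniform_cvgP uf uB]]] := is_cfc_cfc cf.
set B := cfc f A in bB uB *; have [bA sA _] := posA.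
have d0 : 0 <= d by apply: le_trans (hp 0 _); rewrite // lexx; case: AM.
apply: (@le_of_add_eps _ _ _ (2 * rnorm x)) => e e0.
have /cvgr0Pnorm_le/(_ e e0)[n1 _ h1] := uB.
have [n2 _ h2] := uf e e0.
pose n := maxn n1 n2.
have {}h1 := h1 n (leq_maxl _ _); have {}h2 := h2 n (leq_maxr _ _).
have bD := bounded_opB (poly_op_bounded (u n) bA) bB.
have [_ hD] := opnorm_bound bD.
have hpu : rnorm (poly_op p A x - poly_op (u n) A x) <= (d + e) * rnorm x.
  rewrite -poly_opB; apply: (spectral_bound ip_norm) => //.
    by rewrite addr_ge0 // ltW.
  move=> t st; rewrite hornerD hornerN -[p.[t]](subrK (f t)) -addrA.
  apply: le_trans (ler_normD _ _) _; apply: lerD.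
    by apply: hp; exact: (positive_spectrum posA AM st).
  by rewrite distrC; exact: h2.
rewrite -[poly_op p A x](subrK (poly_op (u n) A x)) -addrA.
apply: le_trans (rnormD _ _) _.
have := hD x; rewrite -[(_ - B) x]/(poly_op (u n) A x - B x).
have := ler_wpM2r (rnorm_ge0 x) (le_trans (ler_norm _) h1).
lra.
Qed.

Lemma cfc_approx f e : {within `[0, +oo[, continuous f} -> 0 < e ->
  exists p, (forall t, 0 <= t <= M -> `|p.[t] - f t| <= e) /\
    forall x, rnorm (poly_op p A x - cfc f A x) <= e * rnorm x.
Proof.
move=> cf e0; have M1 : 0 < M + 1 by rewrite ltr_wpDl //; case: AM.
have [p hp] := weierstrass_approximation M1 cf e0.
have {}hp t : 0 <= t <= M -> `|p.[t] - f t| <= e.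
  move=> /andP[t0 tM]; apply: hp; rewrite t0 /=.
  by apply: le_trans tM _; rewrite lerDl.
by exists p; split => // x; exact: cfcP.
Qed.

Lemma cfc_poly f p : {within `[0, +oo[, continuous f} ->
  (forall t, 0 <= t <= M -> f t = p.[t]) -> cfc f A = poly_op p A.
Proof.
move=> cf fp; apply/funext => x; apply/esym/eqP; rewrite -subr_eq0.
apply/eqP/rnorm0_eq0/eqP; rewrite eq_le rnorm_ge0 andbT -[leRHS](mul0r (rnorm x)).
by apply: cfcP => // t t0M; rewrite fp // subrr normr0.
Qed.

Lemma cfc_norm_le f d : {within `[0, +oo[, continuous f} ->
  (forall t, 0 <= t <= M -> `|f t| <= d) ->
  forall x, rnorm (cfc f A x) <= d * rnorm x.
Proof.
move=> cf fd x; rewrite -rnormN -[- _]add0r -[X in X - _](scale0r x) -(poly_opC 0 A).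
by apply: cfcP => // t t0M; rewrite hornerC sub0r normrN fd.
Qed.

Lemma cfc_self_adjoint f : {within `[0, +oo[, continuous f} ->
  self_adjoint ip (cfc f A).
Proof.
move=> cf x y; have [bA sA _] := posA.
apply/eqP; rewrite -subr_eq0; apply/eqP/rnorm0_eq0/eqP.
rewrite eq_le rnorm_ge0 andbT.
apply: (@le_of_add_eps _ _ _ (2 * (rnorm x * rnorm y))) => e e0.
have [p [_ hp]] := cfc_approx cf e0.
have -> : ip (cfc f A x) y - ip x (cfc f A y) =
   ip x (poly_op p A y - cfc f A y) - ip (poly_op p A x - cfc f A x) y.
  by rewrite ipBl ipBr (poly_op_self_adjoint p sA) opprB [in RHS]addrC subrKA.
apply: le_trans (rnormB _ _) _.
have := cauchy_schwarz ip_norm x (poly_op p A y - cfc f A y).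
have := cauchy_schwarz ip_norm (poly_op p A x - cfc f A x) y.
have := ler_wpM2l (rnorm_ge0 x) (hp y).
have := ler_wpM2r (rnorm_ge0 y) (hp x).
lra.
Qed.

(** If p and q approximate f and g, then p q approximates h. The product is a separate [h], so that
    factorizations valid only on the half-line, such as t = sqrt t * sqrt t, apply. *)
Lemma cfc_mul f g h : {within `[0, +oo[, continuous f} ->
  {within `[0, +oo[, continuous g} -> {within `[0, +oo[, continuous h} ->
  (forall t, 0 <= t -> h t = f t * g t) ->
  cfc h A = cfc f A \o cfc g A.
Proof.
move=> cf cg ch hfg; apply/funext => x /=; have [bA sA _] := posA.
have [F F0 hF] := within_continuous_bounded M cf.
have [G G0 hG] := within_continuous_bounded M cg.
apply/eqP; rewrite -subr_eq0; apply/eqP/rnorm0_eq0/eqP.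
rewrite eq_le rnorm_ge0 andbT.
apply: (@le_of_add_eps _ _ _ (2 * (F + 1 + G) * rnorm x)) => e' e'0.
(* With e <= 1 the approximant satisfies |p| <= F + 1, a bound free of [e]. *)
wlog e1 : e' e'0 / e' <= 1.
  move=> wl; have [e1|e1] := leP e' 1; first exact: wl.
  apply: le_trans (wl 1 ltr01 (lexx 1)) _; rewrite !add0r ler_wpM2l ?(ltW e1) //.
  by rewrite !mulr_ge0 ?rnorm_ge0 // !addr_ge0.
pose e := e'; have e0 : 0 < e := e'0.
have [p [hp hpA]] := cfc_approx cf e0.
have [q [hq hqA]] := cfc_approx cg e0.
have hpF t : 0 <= t <= M -> `|p.[t]| <= F + 1.
  move=> tM; rewrite -[p.[t]](subrK (f t)) addrC.
  apply: le_trans (ler_normD _ _) _; apply: lerD; first exact: hF.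
  exact: le_trans (hp t tM) e1.
have hpqh : rnorm (poly_op (p * q) A x - cfc h A x) <= (F + 1 + G) * e * rnorm x.
  apply: cfcP => // t /[dup] tM /andP[t0 _]; rewrite hornerM hfg //.
  have -> : p.[t] * q.[t] - f t * g t =
    p.[t] * (q.[t] - g t) + (p.[t] - f t) * g t by ring.
  apply: le_trans (ler_normD _ _) _; rewrite !normrM mulrDl; apply: lerD.
    by apply: ler_pM => //; [exact: hpF | exact: hq].
  by rewrite mulrC; apply: ler_pM => //; [exact: hG | exact: hp].
rewrite (poly_opM _ _ _ (bounded_op_linear bA)) in hpqh.
have h1 : rnorm (poly_op p A (poly_op q A x - cfc g A x)) <= (F + 1) * (e * rnorm x).
  apply: le_trans (spectral_bound_itv posA AM hpF _) _.
  by rewrite ler_wpM2l // addr_ge0.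
rewrite (linear_propB (bounded_op_linear (poly_op_bounded p bA))) in h1.
have h2 := hpA (cfc g A x).
have h3 := ler_wpM2l (ltW e0) (cfc_norm_le cg hG x).
have -> : cfc h A x - cfc f A (cfc g A x) =
   - (poly_op p A (poly_op q A x) - cfc h A x)
   + (poly_op p A (poly_op q A x) - poly_op p A (cfc g A x))
   + (poly_op p A (cfc g A x) - cfc f A (cfc g A x)).
  by rewrite opprB !subrKA.
apply: le_trans (rnormD _ _) _.
have := rnormD (- (poly_op p A (poly_op q A x) - cfc h A x))
   (poly_op p A (poly_op q A x) - poly_op p A (cfc g A x)).
rewrite rnormN -/e; lra.
Qed.

(** If q approximates f, then q - p approximates h with the same error. It serves to subtract a
    supporting line from [phi], and t from t^2 / (t + e). *)
Lemma cfc_subpoly f h p : {within `[0, +oo[, continuous f} ->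
  {within `[0, +oo[, continuous h} ->
  (forall t, 0 <= t -> h t = f t - p.[t]) ->
  forall x, cfc h A x = cfc f A x - poly_op p A x.
Proof.
move=> cf ch hfp x.
apply/eqP; rewrite -subr_eq0; apply/eqP/rnorm0_eq0/eqP.
rewrite eq_le rnorm_ge0 andbT; apply: (@le_of_add_eps _ _ _ (2 * rnorm x)) => e e0.
have [q [hq hqA]] := cfc_approx cf e0.
have h1 : rnorm (poly_op (q - p) A x - cfc h A x) <= e * rnorm x.
  apply: cfcP => // t /[dup] tM /andP[t0 _]; rewrite hornerD hornerN hfp //.
  have -> : q.[t] - p.[t] - (f t - p.[t]) = q.[t] - f t by ring.
  exact: hq.
have -> : cfc h A x - (cfc f A x - poly_op p A x) =
   (poly_op q A x - cfc f A x) - (poly_op (q - p) A x - cfc h A x).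
  rewrite poly_opB !opprB [RHS]addrCA; congr (_ + _).
  by rewrite [RHS]addrC subrKA.
apply: le_trans (rnormB _ _) _; have := hqA x; lra.
Qed.

(** f is the square of sqrt f, so <f(A) x, x> is the squared norm of (sqrt f)(A) x. *)
Lemma cfc_ge0 f : {within `[0, +oo[, continuous f} ->
  (forall t, 0 <= t -> 0 <= f t) -> forall x, 0 <= rip (cfc f A x) x.
Proof.
move=> cf f0 x.
have cs : {within `[0, +oo[, continuous (Num.sqrt \o f)}.
  by move=> t; exact: (cvg_comp _ _ (cf t) (@sqrt_continuous _ (f t))).
rewrite (cfc_mul cs cs cf); last by move=> t t0; rewrite -expr2 sqr_sqrtr ?f0.
by rewrite /= /re_ip (cfc_self_adjoint cs) -/(re_ip _ _ _) (rip_rnorm ip_norm) sqr_ge0.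
Qed.

Lemma cfc_positive f : {within `[0, +oo[, continuous f} ->
  (forall t, 0 <= t -> 0 <= f t) -> positive_op (cfc f A).
Proof.
move=> cf f0; split; [exact: cfc_bounded | exact: cfc_self_adjoint |].
exact: cfc_ge0.
Qed.
End Cfc.

(** The relation passes to polynomials; the common bound [M] lets one polynomial approximate [f] for
    both operators. *)
Lemma cfc_intertwine A B T M f : positive_op A -> positive_op B ->
  bounded_by M A -> bounded_by M B -> bounded_op T ->
  (forall x, T (A x) = B (T x)) -> {within `[0, +oo[, continuous f} ->
  forall x, T (cfc f A x) = cfc f B (T x).
Proof.
move=> pA pB AM BM bT TAB cf x; have linT := bounded_op_linear bT.
have [K [K0 hK]] := bounded_op_ub bT.
apply/eqP; rewrite -subr_eq0; apply/eqP/rnorm0_eq0/eqP.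
rewrite eq_le rnorm_ge0 andbT.
apply: (@le_of_add_eps _ _ _ (2 * (K * rnorm x))) => e e0.
have [p [hp hpA]] := cfc_approx pA AM cf e0.
have h1 := cfcP pB BM cf hp (T x).
have h2 := hK (poly_op p A x - cfc f A x).
have h3 := ler_wpM2l K0 (hpA x).
have h4 := ler_wpM2l (ltW e0) (hK x).
have -> : T (cfc f A x) - cfc f B (T x) =
   (poly_op p B (T x) - cfc f B (T x)) - T (poly_op p A x - cfc f A x).
  rewrite (linear_propB linT) (poly_op_intertwine p linT TAB) opprB.
  by rewrite [in RHS]addrC subrKA.
apply: le_trans (rnormB _ _) _; lra.
Qed.
End ContinuousCalculus.

(** * Convexity and the numerical radius *)

Section RealFunctions.
Variable R : realType.
Implicit Types (f g phi : R -> R) (s t u v m a b : R).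
Local Notation Rp_continuous f := {within `[0, +oo[, continuous (f : R -> R)}.

Lemma within_continuousM f g : Rp_continuous f -> Rp_continuous g ->
  Rp_continuous (fun t => f t * g t).
Proof. by move=> cf cg t; apply: cvgM; [exact: cf | exact: cg]. Qed.

Lemma within_continuous_subpoly f (p : {poly R}) : Rp_continuous f ->
  Rp_continuous (fun t => f t - p.[t]).
Proof.
move=> cf t; apply: cvgB; first exact: cf.
have cp : Rp_continuous (horner p).
  by apply: continuous_subspaceT; exact: continuous_horner.
exact: cp.
Qed.

Lemma shifted_inverse_continuous (e : R) : 0 < e ->
  continuous (fun t : R => (`|t| + e)^-1).
Proof.
move=> e0 t; apply: cvgV; first by rewrite gt_eqF // ltr_wpDl.
by apply: cvgD; [exact: (@norm_continuous _ R^o) | exact: cvg_cst].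
Qed.

Lemma orlicz_convexE phi : orlicz phi -> forall a b t,
  0 <= a -> 0 <= b -> 0 <= t <= 1 ->
  phi (t * a + (1 - t) * b) <= t * phi a + (1 - t) * phi b.
Proof.
move=> ophi a b t a0 b0 /andP[t0 t1].
have := @orlicz_convex _ _ ophi (Itv01 t0 t1) a b.
rewrite !inE /= !in_itv /= a0 b0 => /(_ isT isT).
by rewrite /conv /=.
Qed.

Lemma orlicz_le phi : orlicz phi -> forall a b, 0 <= a -> a <= b ->
  phi a <= phi b.
Proof.
move=> ophi a b a0 ab; apply: (orlicz_increasing ophi) => //.
  by rewrite in_itv /= a0.
by rewrite in_itv /= (le_trans a0 ab).
Qed.

(** Chords ending at s have smaller slope than chords starting there, so the supremum of the left
    slopes works as m. At s = 0 there are no left chords, and monotonicity allows m = 0. *)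
Lemma orlicz_support phi s : orlicz phi -> 0 <= s ->
  exists m, forall t, 0 <= t -> phi s + m * (t - s) <= phi t.
Proof.
move=> ophi; rewrite le_eqVlt => /orP[/eqP <-|s0].
  by exists 0 => t t0; rewrite mul0r addr0; exact: orlicz_le.
have slope u v : 0 <= u -> u < s -> s < v ->
    (phi s - phi u) / (s - u) <= (phi v - phi s) / (v - s).
  move=> u0 us sv; have uv := lt_trans us sv.
  have su0 : 0 < s - u by rewrite subr_gt0.
  have vs0 : 0 < v - s by rewrite subr_gt0.
  have vu0 : 0 < v - u by rewrite subr_gt0.
  (* This is the weight of u when s is written as a convex combination of u and v. *)
  have lam : 0 <= (v - s) / (v - u) <= 1.
    apply/andP; split; first by apply: divr_ge0; exact: ltW.
    by rewrite ler_pdivrMr // mul1r; lra.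
  have := orlicz_convexE ophi u0 (ltW (lt_trans s0 sv)) lam.
  have -> : (v - s) / (v - u) * u + (1 - (v - s) / (v - u)) * v = s.
    by field; rewrite gt_eqF.
  have -> : (v - s) / (v - u) * phi u + (1 - (v - s) / (v - u)) * phi v =
      ((v - s) * phi u + (s - u) * phi v) / (v - u).
    by field; rewrite gt_eqF.
  rewrite ler_pdivlMr // => h.
  rewrite ler_pdivrMr // mulrAC ler_pdivlMr //; lra.
pose E := [set (phi s - phi u) / (s - u) | u in [set u | 0 <= u < s]].
have s1 : s < s + 1 by rewrite ltrDl.
have ubE v : s < v -> ubound E ((phi v - phi s) / (v - s)).
  by move=> sv _ [u /= /andP[u0 us] <-]; exact: slope.
have E0 : E !=set0 by exists ((phi s - phi 0) / (s - 0)), 0 => //=; rewrite lexx.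
have hubE : has_ubound E by exists ((phi (s + 1) - phi s) / (s + 1 - s)); exact: ubE.
exists (sup E) => t t0; have [ts|st|->] := ltgtP t s; last by rewrite subrr mulr0 addr0.
- have : (phi s - phi t) / (s - t) <= sup E.
    by apply: (ub_le_sup hubE); exists t => //=; rewrite t0.
  by rewrite ler_pdivrMr ?subr_gt0 //; lra.
- have : sup E <= (phi t - phi s) / (t - s) by apply: ge_sup => //; exact: ubE.
  by rewrite ler_pdivlMr ?subr_gt0 //; lra.
Qed.
End RealFunctions.

Section NumericalRadius.
Variables (R : realType) (H : completeNormedModType R[i]).
Variable ip : {dot H for @Num.conj R[i]}.
Hypothesis ip_norm : induces_norm ip.
Implicit Types (x y : H) (t e K M N alpha : R) (S T A B G : H -> H).
Implicit Types (f g h phi : R -> R).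
Local Notation rip := (re_ip ip).
Local Notation "T ^*" := (adjoint ip T).
Local Notation Rp_continuous f := {within `[0, +oo[, continuous (f : R -> R)}.

Lemma jensen_cfc A phi x : positive_op ip A -> orlicz phi -> rnorm x = 1 ->
  phi (rip (A x) x) <= rip (cfc phi A x) x.
Proof.
move=> posA ophi x1; have [bA _ pA] := posA.
have [M AM] := bounded_op_ub bA.
set s := rip (A x) x; have [m hm] := orlicz_support ophi (pA x).
rewrite -/s in hm.
(* The supporting line at s. As x is a unit vector, <p(A) x, x> = p(s) = phi s. *)
pose p : {poly R} := m%:P * 'X - (m * s - phi s)%:P.
have cphi := orlicz_continuous ophi.
have cf := within_continuous_subpoly (p := p) cphi.
have pE t : p.[t] = phi s + m * (t - s) by rewrite /p !hornerE; ring.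
have := cfc_ge0 ip_norm posA AM cf.
move=> /(_ _ x); rewrite (cfc_subpoly ip_norm posA AM (p := p) cphi cf) //.
rewrite ripBl poly_opB poly_opM ?poly_opC ?poly_opX; last exact: bounded_op_linear.
rewrite ripBl !ripZl (rip_rnorm ip_norm) x1 -/s expr1n mulr1.
have -> : m * s - (m * s - phi s) = phi s by ring.
rewrite subr_ge0; apply => t t0; rewrite pE subr_ge0; exact: hm.
Qed.

Lemma self_adjoint_iter2 G x : self_adjoint ip G ->
  rip (iter 2 G x) x = rnorm (G x) ^+ 2.
Proof. by move=> sG; rewrite /re_ip sG -/(re_ip _ _ _) (rip_rnorm ip_norm). Qed.

Lemma self_adjoint_iter4 G x : self_adjoint ip G ->
  rip (iter 4 G x) x = rnorm (G (G x)) ^+ 2.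
Proof. by move=> sG; rewrite /re_ip 2!sG -/(re_ip _ _ _) (rip_rnorm ip_norm). Qed.

Lemma iter2_positive G : bounded_op G -> self_adjoint ip G ->
  positive_op ip (iter 2 G).
Proof.
move=> bG sG; split; first exact: bounded_op_iter.
  by move=> x y /=; rewrite !sG.
by move=> x; rewrite self_adjoint_iter2 // sqr_ge0.
Qed.

Lemma iter4_positive G : bounded_op G -> self_adjoint ip G ->
  positive_op ip (iter 4 G).
Proof.
move=> bG sG; split; first exact: bounded_op_iter.
  by move=> x y /=; rewrite !sG.
by move=> x; rewrite self_adjoint_iter4 // sqr_ge0.
Qed.

Lemma adjointPl T x y : bounded_op T -> ip (T^* x) y = ip x (T y).
Proof. by move=> bT; rewrite ipC -(adjointP ip_norm) // -ipC. Qed.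

(** * The absolute value of an operator and the mixed Schwarz inequality *)

Section AbsoluteValue.
Variables (T : H -> H) (bT : bounded_op T).

Lemma adjoint_comp_positive : positive_op ip (T^* \o T).
Proof.
have bTs := adjoint_bounded ip_norm bT.
split; first exact: bounded_op_comp.
  by move=> x y /=; rewrite adjointPl // (adjointP ip_norm).
move=> x; rewrite ripC /re_ip /= -(adjointP ip_norm) // -/(re_ip _ _ _).
by rewrite (rip_rnorm ip_norm) sqr_ge0.
Qed.

Lemma adjoint_comp_bounded_by K : bounded_by K T -> bounded_by (K * K) (T^* \o T).
Proof.
by move=> hK; apply: bounded_by_comp => //; exact: bounded_by_adjoint.
Qed.

Lemma sqrt_within_continuous : Rp_continuous Num.sqrt.
Proof. by apply: continuous_subspaceT; exact: sqrt_continuous. Qed.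

Lemma id_within_continuous : Rp_continuous id.
Proof. by apply: continuous_subspaceT => t; exact: cvg_id. Qed.

Lemma absop_positive : positive_op ip (absop ip T).
Proof.
have [K hK] := bounded_op_ub bT.
apply: (cfc_positive ip_norm adjoint_comp_positive (adjoint_comp_bounded_by hK)).
  exact: sqrt_within_continuous.
by move=> t _; exact: sqrtr_ge0.
Qed.

Lemma absop_sqr x : absop ip T (absop ip T x) = T^* (T x).
Proof.
have [K hK] := bounded_op_ub bT.
have posA := adjoint_comp_positive; have AM := adjoint_comp_bounded_by hK.
have E : forall t, 0 <= t -> id t = Num.sqrt t * Num.sqrt t.
  by move=> t t0; rewrite -expr2 sqr_sqrtr.
have := cfc_mul ip_norm posA AM sqrt_within_continuous sqrt_within_continuous
  id_within_continuous E.
rewrite (cfc_poly ip_norm posA AM id_within_continuous (p := 'X)); last first.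
  by move=> t _; rewrite hornerX.
by move/(congr1 (fun F => F x)); rewrite poly_opX => /esym.
Qed.

Lemma rnorm_absop x : rnorm (absop ip T x) = rnorm (T x).
Proof.
have [_ sabs _] := absop_positive.
apply/eqP; rewrite -(eqrXn2 (n := 2)) ?rnorm_ge0 //; apply/eqP.
rewrite -!(rip_rnorm ip_norm) /re_ip sabs absop_sqr.
by rewrite -(adjointP ip_norm).
Qed.

Lemma absop_bounded_by K : bounded_by K T -> bounded_by K (absop ip T).
Proof. by case=> K0 hK; split => // x; rewrite rnorm_absop. Qed.
End AbsoluteValue.

(** T intertwines its two products with the adjoint, by associativity, and the square root follows
    by [cfc_intertwine]. *)
Lemma absop_intertwine T x : bounded_op T ->
  T (absop ip T x) = absop ip T^* (T x).
Proof.
move=> bT; have [K hK] := bounded_op_ub bT.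
have bTs := adjoint_bounded ip_norm bT; have hKs := bounded_by_adjoint ip_norm bT hK.
apply: (cfc_intertwine ip_norm (adjoint_comp_positive bT) (adjoint_comp_positive bTs)
  (adjoint_comp_bounded_by bT hK) (adjoint_comp_bounded_by bTs hKs) bT) => //.
  by move=> y /=; rewrite (adjointK ip_norm).
exact: sqrt_within_continuous.
Qed.

(* T is the limit, as e tends to 0, of h(|T^*|) o T (|T| + e)^-1 o g(|T|), and
   T (|T| + e)^-1 is a contraction; this replaces the polar decomposition. *)
Lemma mixed_schwarz T g h x y : bounded_op T ->
  Rp_continuous g -> Rp_continuous h -> (forall t, 0 <= t -> g t * h t = t) ->
  rnorm (ip (T x) y) <= rnorm (cfc g (absop ip T) x) * rnorm (cfc h (absop ip T^*) y).
Proof.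
move=> bT cg ch gh; have linT := bounded_op_linear bT.
have bTs := adjoint_bounded ip_norm bT.
have [K hK] := bounded_op_ub bT; have hKs := bounded_by_adjoint ip_norm bT hK.
have posA := absop_positive bT; have AM := absop_bounded_by bT hK.
have posB := absop_positive bTs; have BM := absop_bounded_by bTs hKs.
set A := absop ip T in posA AM *; set B := absop ip T^* in posB BM *.
have [bA _ _] := posA.
apply: (@le_of_add_eps _ _ _ (rnorm x * rnorm y)) => e e0.
(* The absolute value keeps the denominator positive on the whole line. *)
pose k t := (`|t| + e)^-1.
have ck : Rp_continuous k.
  by apply: continuous_subspaceT; exact: shifted_inverse_continuous.
have cid := id_within_continuous.
pose r t := t * k t.
have cr : Rp_continuous r by exact: within_continuousM.
have ckg := within_continuousM ck cg.
have cq := within_continuousM cid cr.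
pose p : {poly R} := 'X.
have cqp := within_continuous_subpoly (p := p) cq.
have AX : cfc id A = A.
  rewrite (cfc_poly ip_norm posA AM cid (p := 'X)).
    by apply/funext => z; rewrite poly_opX.
  by move=> t _; rewrite hornerX.
have rE t : 0 <= t -> r t = t / (t + e) by move=> t0; rewrite /r /k ger0_norm.
have rkg : cfc r A = cfc h A \o (cfc k A \o cfc g A).
  rewrite -(cfc_mul ip_norm posA AM ck cg ckg) //.
  apply: (cfc_mul ip_norm posA AM ch ckg cr) => t t0.
  by rewrite /r -{1}(gh t t0); ring.
have rk : cfc r A = A \o cfc k A.
  by have := cfc_mul ip_norm posA AM cid ck cr (fun _ _ => erefl); rewrite AX.
have qr : cfc (fun t => t * r t) A = A \o cfc r A.
  by have := cfc_mul ip_norm posA AM cid cr cq (fun _ _ => erefl); rewrite AX.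
set G := cfc g A; set Hs := cfc h B.
pose U := cfc k A (G x).
have TU : rnorm (T U) <= rnorm (G x).
  rewrite -(rnorm_absop bT) -/A -[A U]/((A \o cfc k A) (G x)) -rk -[leRHS]mul1r.
  apply: (cfc_norm_le ip_norm posA AM cr) => t /andP[t0 _].
  rewrite rE // ger0_norm ?divr_ge0 ?addr_ge0 ?(ltW e0) //.
  by rewrite ler_pdivrMr ?ltr_wpDl // mul1r lerDl ltW.
(* On the half-line r = h k g, so r(A) x = h(A) U; intertwining moves h(A) across T, where it
   becomes h(B). *)
have HTU : Hs (T U) = T (cfc r A x).
  rewrite rkg /= -/G -/U /Hs; apply/esym.
  apply: (cfc_intertwine ip_norm posA posB AM BM bT) => // z.
  exact: absop_intertwine.
have Tr : rnorm (T x - T (cfc r A x)) <= e * rnorm x.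
  rewrite -(linear_propB linT) -(rnorm_absop bT) -/A.
  rewrite (linear_propB (bounded_op_linear bA)) rnorm_distC.
  rewrite -[A (cfc r A x)]/((A \o cfc r A) x) -qr -[A x in X in X <= _]poly_opX.
  rewrite -(cfc_subpoly ip_norm posA AM cq cqp) //.
  apply: (cfc_norm_le ip_norm posA AM cqp) => t /andP[t0 _].
  have te : 0 < t + e by rewrite ltr_wpDl.
  (* The regularization error has size e t / (t + e) <= e. *)
  have -> : t * r t - p.[t] = - (e * (t / (t + e))).
    by rewrite rE // /p hornerX; field; rewrite gt_eqF.
  rewrite normrN ger0_norm ?mulr_ge0 ?invr_ge0 ?(ltW te) ?(ltW e0) //.
  by rewrite ler_piMr ?(ltW e0) // ler_pdivrMr // mul1r lerDl ltW.
have sHs : self_adjoint ip Hs by exact: cfc_self_adjoint BM _ ch.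
have -> : ip (T x) y = ip (T x - T (cfc r A x)) y + ip (T U) (Hs y).
  by rewrite -sHs HTU -ipDl subrK.
apply: le_trans (rnormD _ _) _; rewrite addrC; apply: lerD.
  apply: le_trans (cauchy_schwarz ip_norm _ _) _.
  by rewrite ler_wpM2r ?rnorm_ge0.
apply: le_trans (cauchy_schwarz ip_norm _ _) _.
by rewrite mulrAC ler_wpM2r ?rnorm_ge0 // mulrC.
Qed.

(** The supremum need not be attained. If phi (w^2) > N, continuity makes phi (t^2) > N for t near
    w, and some unit vector has its value there. *)
Lemma numrad_le T phi N : bounded_op T -> orlicz phi -> 0 <= N ->
  (forall x, rnorm x = 1 -> phi (rnorm (ip (T x) x) ^+ 2) <= N) ->
  phi (numrad ip T ^+ 2) <= N.
Proof.
move=> bT ophi N0 hN; have [K [K0 hK]] := bounded_op_ub bT.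
have unit x : `|x| = 1 -> rnorm x = 1 by rewrite /rnorm => ->.
rewrite /numrad; set E := [set _ | _ in _].
(* For trivial [H] there are no unit vectors and the supremum takes its default value 0. *)
have [->|/set0P E0] := eqVneq E set0; first by rewrite sup0 expr0n /= (orlicz0 ophi).
have hE : has_sup E.
  split => //; exists K => _ [x /= /unit x1 <-].
  apply: le_trans (cauchy_schwarz ip_norm _ _) _.
  by rewrite x1 mulr1; have := hK x; rewrite x1 mulr1.
rewrite leNgt; apply/negP => Nw.
pose F (t : R) := phi `|t ^+ 2|.
have cF : continuous F.
  move=> t; apply: (@continuous_comp _ _ _ (fun s : R => s ^+ 2) (fun s => phi `|s|)).
    exact: exprn_continuous.
  exact: within_continuous_normr (orlicz_continuous ophi) _.
have FE t : F t = phi (t ^+ 2) by rewrite /F ger0_norm // sqr_ge0.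
rewrite -FE in Nw.
have nE : \forall t \near sup E, N < F t by exact: (cvgr_gt _ (cF (sup E))).
move/nbhs_ballP: nE => [d /= d0 hd].
have [_ [x /= x1 <-] hx] := sup_adherent d0 hE.
have := hN x (unit x x1); rewrite leNgt -FE => /negP; apply.
apply: hd; rewrite -ball_normE /= ger0_norm.
  by rewrite ltrBlDr addrC -ltrBlDr.
by rewrite subr_ge0; apply: (ub_le_sup hE.2); exists x.
Qed.

(** Here [A], [G] and [S] stand for |T|, g(|T|) and h(|T^*|), reduced to a norm identity and a
    Schwarz bound. *)
Lemma phi_numrad_le_of_schwarz T A G S phi alpha : bounded_op T ->
  bounded_op A -> bounded_op G -> bounded_op S ->
  self_adjoint ip A -> self_adjoint ip G -> self_adjoint ip S ->
  (forall x, rnorm (A x) = rnorm (T x)) ->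
  (forall x, rnorm (ip (T x) x) <= rnorm (G x) * rnorm (S x)) ->
  orlicz phi -> 0 <= alpha <= 1 ->
  phi (numrad ip T ^+ 2) <=
    opnorm ((alpha / 2)%:C *: (cfc phi (iter 4 G) + cfc phi (iter 4 S))
            + (1 - alpha)%:C *: cfc phi (iter 2 A)).
Proof.
move=> bT bA bG bS sA sG sS AT hGS ophi alpha01; have /andP[a0 a1] := alpha01.
have pG := iter4_positive bG sG; have pS := iter4_positive bS sS.
have pA := iter2_positive bA sA.
set Op := (X in opnorm X).
have bphi B : positive_op ip B -> bounded_op (cfc phi B).
  by move=> pB; exact: (cfc_bounded ip_norm pB (orlicz_continuous ophi)).
have bOp : bounded_op Op.
  apply: bounded_opD; last exact: (bounded_opZ _ (bphi _ pA)).
  exact: (bounded_opZ _ (bounded_opD (bphi _ pG) (bphi _ pS))).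
have [N0 hOp] := opnorm_bound bOp.
apply: numrad_le => // x x1.
set a := rnorm (ip (T x) x).
pose u := rip (iter 4 G x) x; pose v := rip (iter 4 S x) x.
pose w := rip (iter 2 A x) x.
have u0 : 0 <= u by case: pG => _ _ /(_ x).
have v0 : 0 <= v by case: pS => _ _ /(_ x).
have w0 : 0 <= w by case: pA => _ _ /(_ x).
(* For a unit vector |B x|^2 = <B^2 x, x> <= |B^2 x|; squaring gives the claim. *)
have sqr_le B : self_adjoint ip B -> rnorm (B x) ^+ 4 <= rip (iter 4 B x) x.
  move=> sB; rewrite self_adjoint_iter4 // -[4%N]/(2 * 2)%N exprM.
  rewrite ler_sqr ?nnegrE ?sqr_ge0 ?rnorm_ge0 //.
  rewrite -(self_adjoint_iter2 _ sB) /=; apply: le_trans (rip_le ip_norm _ _) _.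
  by rewrite x1 mulr1.
have auv : a ^+ 2 <= 2^-1 * u + (1 - 2^-1) * v.
  have h1 := hGS x; rewrite -/a in h1.
  have := sqr_le G sG; have := sqr_le S sS; rewrite -/u -/v => hv hu.
  have h2 : a ^+ 2 <= (rnorm (G x) * rnorm (S x)) ^+ 2.
    by rewrite ler_sqr ?nnegrE ?mulr_ge0 ?rnorm_ge0.
  have := sqr_ge0 (rnorm (G x) ^+ 2 - rnorm (S x) ^+ 2); nra.
have aw : a ^+ 2 <= w.
  rewrite /w self_adjoint_iter2 // AT ler_sqr ?nnegrE ?rnorm_ge0 //.
  by apply: le_trans (cauchy_schwarz ip_norm _ _) _; rewrite x1 mulr1.
pose z := 2^-1 * u + (1 - 2^-1) * v.
have half : 0 <= (2^-1 : R) <= 1 by rewrite invr_ge0 ler0n /= invf_le1 ?ler1n.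
have z0 : 0 <= z by rewrite /z; lra.
have aaz : a ^+ 2 <= alpha * z + (1 - alpha) * w by rewrite -/z in auv; nra.
apply: le_trans (orlicz_le ophi (sqr_ge0 a) aaz) _.
apply: le_trans (orlicz_convexE ophi z0 w0 alpha01) _.
have hz := orlicz_convexE ophi u0 v0 half; rewrite -/z in hz.
have ju := jensen_cfc pG ophi x1; have jv := jensen_cfc pS ophi x1.
have jw := jensen_cfc pA ophi x1.
rewrite -/u in ju; rewrite -/v in jv; rewrite -/w in jw.
have fin : rip (Op x) x <= opnorm Op.
  apply: le_trans (rip_le ip_norm _ _) _; rewrite x1 mulr1.
  by have := hOp x; rewrite x1 mulr1.
apply: le_trans fin.
rewrite -[Op x]/((alpha / 2)%:C *: (cfc phi (iter 4 G) x + cfc phi (iter 4 S) x)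
  + (1 - alpha)%:C *: cfc phi (iter 2 A) x).
rewrite ripDl !ripZl ripDl.
have h1 := ler_wpM2l a0 hz.
have a1' : 0 <= 1 - alpha by rewrite subr_ge0.
have h2 := ler_wpM2l a1' jw.
have h3 := ler_wpM2l a0 (lerD ju jv).
lra.
Qed.

Lemma phi_numrad_le T g h phi alpha : bounded_op T ->
  Rp_continuous g -> Rp_continuous h -> (forall t, 0 <= t -> g t * h t = t) ->
  orlicz phi -> 0 <= alpha <= 1 ->
  phi (numrad ip T ^+ 2) <=
    opnorm ((alpha / 2)%:C *: (cfc phi (iter 4 (cfc g (absop ip T)))
                               + cfc phi (iter 4 (cfc h (absop ip T^*))))
            + (1 - alpha)%:C *: cfc phi (iter 2 (absop ip T))).
Proof.
move=> bT cg ch gh; have bTs := adjoint_bounded ip_norm bT.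
have posA := absop_positive bT; have posB := absop_positive bTs.
have [bA sA _] := posA; have [bB _ _] := posB.
have [MA AM] := bounded_op_ub bA; have [MB BM] := bounded_op_ub bB.
apply: (phi_numrad_le_of_schwarz bT bA (cfc_bounded ip_norm posA cg)
  (cfc_bounded ip_norm posB ch) sA (cfc_self_adjoint ip_norm posA AM cg)
  (cfc_self_adjoint ip_norm posB BM ch)) => x; first exact: rnorm_absop.
exact: mixed_schwarz.
Qed.

Lemma numrad_adjoint T : bounded_op T -> numrad ip T^* = numrad ip T.
Proof.
move=> bT; have E x : complex.Re `|ip (T^* x) x| = complex.Re `|ip (T x) x|.
  by rewrite adjointPl // ipC norm_conjC.
by rewrite /numrad; congr sup; apply/seteqP; split => _ [x x1 <-]; exists x.
Qed.
End NumericalRadius.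

Theorem theorem2p18 (R : realType) (H : completeNormedModType R[i])
    (ip : {dot H for @Num.conj R[i]}) (ip_norm : induces_norm ip)
    (T : H -> H) (T_bounded : bounded_op T)
    (g h : R -> R)
    (g_ge0 : forall t, 0 <= t -> 0 <= g t)
    (h_ge0 : forall t, 0 <= t -> 0 <= h t)
    (g_cont : {within `[0, +oo[, continuous g})
    (h_cont : {within `[0, +oo[, continuous h})
    (gh : forall t, 0 <= t -> g t * h t = t)
    (phi : R -> R) (phi_orlicz : orlicz phi)
    (alpha : R) (alpha01 : 0 <= alpha <= 1) :
  let absT := absop ip T in
  let absTs := absop ip (adjoint ip T) in
  phi (numrad ip T ^+ 2) <=
    opnorm ((alpha / 2)%:C *: (cfc phi (iter 4 (cfc g absT))
                               + cfc phi (iter 4 (cfc h absTs)))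
            + (1 - alpha)%:C *: cfc phi (iter 2 absT)) /\
  phi (numrad ip T ^+ 2) <=
    opnorm ((alpha / 2)%:C *: (cfc phi (iter 4 (cfc g absTs))
                               + cfc phi (iter 4 (cfc h absT)))
            + (1 - alpha)%:C *: cfc phi (iter 2 absTs)).

Proof.
move=> absT absTs; split; first exact: phi_numrad_le.
have bTs := adjoint_bounded ip_norm T_bounded.
(* The second bound is the first one for the adjoint of [T]; [adjointK] restores [T]. *)
rewrite -(numrad_adjoint ip_norm T_bounded).
have := phi_numrad_le ip_norm bTs g_cont h_cont gh phi_orlicz alpha01.
by rewrite /= (adjointK ip_norm T_bounded).
Qed.
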